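(* Let $G$ be a locally hyperdefinable group with a global logic topology. Then $G$ with its global logic topology is a locally compact topological group. Furthermore, a countably piecewise hyperdefinable group $G$ is a locally compact topological group with some logic topology if and only if this logic topology is the global logic topology and $G$ is locally hyperdefinable.
   Context: Fix a first-order many-sorted language $\mathcal{L}$ and a $\kappa$-saturated, strongly $\kappa$-homogeneous $\mathcal{L}$-structure $\mathfrak{M}$, with $\kappa>|\mathcal{L}|$ a strong limit cardinal; ''small'' means of cardinality $<\kappa$. A hyperdefinable set is a quotient $P=X/E$ of a nonempty type-definable set $X$ by a type-definable equivalence relation $E$; its elements are hyperimaginaries. Parameter sets $A$ are small sets of hyperimaginaries; $\mathrm{Aut}(\mathfrak{M}/A)$ fixes each element of $A$. $P$ is $A$-hyperdefinable if $X,E$ are $\mathrm{Aut}(\mathfrak{M}/A)$-invariant; a subset of $P$ is $\bigwedge_A$-definable if its preimage in $X$ is type-definable and $\mathrm{Aut}(\mathfrak{M}/A)$-invariant. A piecewise $A$-hyperdefinable set is a direct limit $P=\varinjlim_{i\in I}P_i$ of a directed system of $A$-hyperdefinable sets with injective $\bigwedge_A$-definable transition maps, $\mathrm{cf}(I)<\kappa$; the $P_i$ are the pieces. $V\subseteq P$ is piecewise $\bigwedge_A$-definable if each $V\cap P_i$ is $\bigwedge_A$-definable, and $\bigwedge_A$-definable if moreover contained in a piece. The $A$-logic topology has as closed sets the piecewise $\bigwedge_A$-definable sets; a logic topology is the $A$-logic topology for some small $A$. At most one logic topology is $T_1$ (if the $A$-logic topology is $T_1$ it coincides with the $A'$-logic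 topology for all small $A'\supseteq A$); it is called the global logic topology, when it exists. $P$ is countably piecewise hyperdefinable if $I$ has countable cofinality. $P$ is locally $A$-hyperdefinable if each point has an $\bigwedge_A$-definable neighbourhood in the $A$-logic topology; locally hyperdefinable if so for some small $A$. A piecewise hyperdefinable group is a group whose universe is piecewise $A$-hyperdefinable (some small $A$) and whose operations are piecewise bounded (pieces map into pieces) with piecewise $\bigwedge_A$-definable graphs (products being $\varinjlim P_i\times Q_j$). Topological groups are assumed Hausdorff.
   Formalization: A small set A of hyperimaginaries is also required to be fixed by all automorphisms fixing some small real tuple; this is automatic for regular κ, and for singular κ it is needed for the A-logic topology to be a topology. *)

(* Defs.v *)
From HB Require Import structures.
From mathcomp Require Import all_boot all_order.
From mathcomp Require Import all_classical all_reals all_analysis.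

Set Implicit Arguments.
Unset Strict Implicit.
Unset Printing Implicit Defensive.

Local Open Scope classical_set_scope.

(* Cardinals are represented by types: the cardinal kappa is that of K. *)

Definition card_lt (T U : Type) : Prop :=
  ([set: T] #<= [set: U])%card /\ ~ ([set: U] #<= [set: T])%card.

Definition strong_limit (K : Type) : Prop :=
  infinite_set [set: K] /\
  forall T : Type, card_lt T K -> card_lt (set T) K.

Record language := Language {
  lsort : Type;
  fsym : Type;
  far : fsym -> nat;
  fdom : forall f : fsym, 'I_(far f) -> lsort;
  fcod : fsym -> lsort;
  rsym : Type;
  rar : rsym -> nat;
  rdom : forall r : rsym, 'I_(rar r) -> lsort
}.

(* The usual convention |L| = max(aleph_0, number of symbols of L), that is,
   the number of L-formulas. *)
Definition language_card (L : language) : Type :=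
  (nat + lsort L + fsym L + rsym L)%type.

(* A context is a (possibly infinite) family of sorted variables. *)
Record ctx (L : language) := Ctx { var : Type; vsort : var -> lsort L }.

Section Syntax.
Variable L : language.

Definition ctx_snoc (V : ctx L) (s : lsort L) : ctx L :=
  Ctx (fun o : option (var V) =>
    match o with Some v => vsort v | None => s end).

Definition ctx_cat (V W : ctx L) : ctx L :=
  Ctx (fun u : var V + var W =>
    match u with inl v => vsort v | inr w => vsort w end).

Inductive term (V : ctx L) : lsort L -> Type :=
| Var (v : var V) : term V (vsort v)
| App (f : fsym L) (ts : forall i : 'I_(far f), term V (fdom i)) :
    term V (fcod f).

Inductive formula (V : ctx L) : Type :=
| Fbot
| Feq (s : lsort L) (t u : term V s)
| Frel (r : rsym L) (ts : forall i : 'I_(rar r), term V (rdom i))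
| Fimp (p q : formula V)
| Fall (s : lsort L) (p : formula (ctx_snoc V s)).

End Syntax.

Record structure (L : language) := Structure {
  carrier :> lsort L -> Type;
  finterp : forall f : fsym L,
    (forall i : 'I_(far f), carrier (fdom i)) -> carrier (fcod f);
  rinterp : forall r : rsym L,
    (forall i : 'I_(rar r), carrier (rdom i)) -> Prop
}.

Section Semantics.
Variables (L : language) (M : structure L).

Definition tuple_of (V : ctx L) := forall v : var V, M (vsort v).

Definition tuple_snoc (V : ctx L) (a : tuple_of V) (s : lsort L) (m : M s) :
    tuple_of (ctx_snoc V s) :=
  fun o => match o with Some v => a v | None => m end.

Definition tuple_cat (V W : ctx L) (a : tuple_of V) (b : tuple_of W) :
    tuple_of (ctx_cat V W) :=
  fun u => match u with inl v => a v | inr w => b w end.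

Fixpoint term_eval (V : ctx L) (a : tuple_of V) (s : lsort L) (t : term V s) :
    M s :=
  match t with
  | Var v => a v
  | App f ts => finterp (fun i => term_eval a (ts i))
  end.

Fixpoint holds_at (V : ctx L) (p : formula V) : tuple_of V -> Prop :=
  match p with
  | Fbot => fun _ => False
  | Feq s t u => fun a => term_eval a t = term_eval a u
  | Frel r ts => fun a => rinterp (fun i => term_eval a (ts i))
  | Fimp p q => fun a => holds_at p a -> holds_at q a
  | Fall s p => fun a => forall m : M s, holds_at p (tuple_snoc a m)
  end.

Record automorphism := Automorphism {
  aut :> forall s : lsort L, M s -> M s;
  aut_bij : forall s, bijective (@aut s);
  aut_fun : forall (f : fsym L) (x : forall i : 'I_(far f), M (fdom i)),
    aut (finterp x) = finterp (fun i => aut (x i));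
  aut_rel : forall (r : rsym L) (x : forall i : 'I_(rar r), M (rdom i)),
    rinterp (fun i => aut (x i)) <-> rinterp x
}.

Definition aut_tuple (g : automorphism) (V : ctx L) (a : tuple_of V) :
    tuple_of V :=
  fun v => g _ (a v).

(* The automorphism g leaves S globally (not pointwise) invariant. *)
Definition aut_stable (g : automorphism) (V : ctx L) (S : set (tuple_of V)) :=
  forall a, S (aut_tuple g a) <-> S a.

Variable K : Type.

Definition small (T : Type) : Prop := card_lt T K.

(* Every finitely satisfiable set of formulas in one variable, with a small
   set of parameters (enumerated by b), is realised. *)
Definition saturated : Prop :=
  forall (W : ctx L) (b : tuple_of W) (s : lsort L)
    (Phi : set (formula (ctx_snoc W s))),
  small (var W) ->
  (forall F : set (formula (ctx_snoc W s)), finite_set F -> F `<=` Phi ->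
    exists m : M s, forall p, F p -> holds_at p (tuple_snoc b m)) ->
  exists m : M s, forall p, Phi p -> holds_at p (tuple_snoc b m).

Definition strongly_homogeneous : Prop :=
  forall (W : ctx L) (a b : tuple_of W), small (var W) ->
  (forall p : formula W, holds_at p a <-> holds_at p b) ->
  exists g : automorphism, aut_tuple g a = b.

(* There is no bound on Phi: when kappa > |L| and V, W are small there are
   fewer than kappa formulas in all. *)
Definition type_definable (V : ctx L) (S : set (tuple_of V)) : Prop :=
  exists (W : ctx L) (b : tuple_of W) (Phi : set (formula (ctx_cat V W))),
    small (var W) /\
    forall a, S a <-> forall p, Phi p -> holds_at p (tuple_cat a b).

Definition pair_set (V W : ctx L) (R : tuple_of V -> tuple_of W -> Prop) :
    set (tuple_of (ctx_cat V W)) :=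
  [set z | R (fun v => z (inl v)) (fun w => z (inr w))].

End Semantics.

(* The quotient X / E, as the type of classes of E on X. *)
Definition classes (T : Type) (X : set T) (E : T -> T -> Prop) : Type :=
  {C : set T | exists2 x, X x & C = E x}.

Section Hyperdefinable.
Variables (L : language) (M : structure L) (K : Type).

Record hyperdefinable := Hyperdefinable {
  hvar : ctx L;
  hX : set (tuple_of M hvar);
  hE : tuple_of M hvar -> tuple_of M hvar -> Prop;
  hvar_small : small K (var hvar);
  hX_neq0 : hX !=set0;
  hX_def : type_definable K hX;
  hE_def : type_definable K (pair_set hE);
  hE_sub : forall x y, hE x y -> hX x /\ hX y;
  hE_refl : forall x, hX x -> hE x x;
  hE_sym : forall x y, hE x y -> hE y x;
  hE_trans : forall x y z, hE x y -> hE y z -> hE x z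
}.

Definition hquot (P : hyperdefinable) : Type := classes (@hX P) (@hE P).

Record hyperimaginary := Hyperimaginary {
  hi_set : hyperdefinable;
  hi_elt : hquot hi_set
}.

Record param_set := ParamSet {
  pidx : Type;
  pelt : pidx -> hyperimaginary
}.

Definition fixes (g : automorphism M) (A : param_set) : Prop :=
  forall i : pidx A, aut_stable g (sval (hi_elt (pelt i))).

(* A small set of hyperimaginaries is one with a small set of representatives,
   in the sense that it is fixed by the automorphisms fixing some small real
   tuple b. When kappa is regular, or when every hyperimaginary is a class of
   a finite tuple for a relation definable without parameters, the second
   clause follows from the first by taking b to consist of representatives and
   of the parameters of the relations; for kappa singular it excludes small
   families whose representatives are not jointly small. *)
Definition small_param_set (A : param_set) : Prop :=
  small K (pidx A) /\
  exists (W : ctx L) (b : tuple_of M W), small K (var W) /\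
    forall g : automorphism M, aut_tuple g b = b -> fixes g A.

Definition param_invariant (A : param_set) (V : ctx L)
    (S : set (tuple_of M V)) :=
  forall g : automorphism M, fixes g A -> aut_stable g S.

Definition bigwedge (A : param_set) (V : ctx L) (S : set (tuple_of M V)) :=
  type_definable K S /\ param_invariant A S.

Definition hyperdefinable_over (A : param_set) (P : hyperdefinable) : Prop :=
  param_invariant A (@hX P) /\ param_invariant A (pair_set (@hE P)).

(* Preimages in X, X x Y and X x Y x Z of subsets of P = X/E, of P x Q and of
   P x Q x R. *)
Definition preim1 (P : hyperdefinable) (D : set (hquot P)) :
    set (tuple_of M (hvar P)) :=
  [set x | exists2 c, D c & sval c x].

Definition preim2 (P Q : hyperdefinable) (D : hquot P -> hquot Q -> Prop) :
    set (tuple_of M (ctx_cat (hvar P) (hvar Q))) :=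
  pair_set (fun x y => exists c d, [/\ D c d, sval c x & sval d y]).

Definition preim3 (P Q R : hyperdefinable)
    (D : hquot P -> hquot Q -> hquot R -> Prop) :
    set (tuple_of M (ctx_cat (ctx_cat (hvar P) (hvar Q)) (hvar R))) :=
  pair_set (fun xy z => exists e,
    preim2 (fun c d => D c d e) xy /\ sval e z).

(* Directed systems of hyperdefinable sets; definability over A of the pieces
   and of the transition maps is piecewise_over below. *)
Record piecewise := Piecewise {
  pindex : Type;
  piece_le : pindex -> pindex -> Prop;
  piece : pindex -> hyperdefinable;
  transition : forall i j, piece_le i j -> hquot (piece i) -> hquot (piece j);
  pindex_inh : inhabited pindex;
  pindex_refl : forall i, piece_le i i;
  pindex_trans : forall i j k, piece_le i j -> piece_le j k -> piece_le i k;
  pindex_directed : forall i j, exists k, piece_le i k /\ piece_le j k;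
  pindex_cof : exists C : set pindex,
    small K C /\ forall i, exists2 j, C j & piece_le i j;
  transition_id : forall i (h : piece_le i i) x, transition h x = x;
  transition_comp : forall i j k (hij : piece_le i j) (hjk : piece_le j k)
      (hik : piece_le i k) x,
    transition hjk (transition hij x) = transition hik x;
  transition_inj : forall i j (h : piece_le i j), injective (transition h)
}.

Definition piecewise_over (A : param_set) (P : piecewise) : Prop :=
  (forall i : pindex P, hyperdefinable_over A (piece i)) /\
  (forall (i j : pindex P) (h : piece_le i j),
    bigwedge A (preim2 (fun c d => transition h c = d))).

Definition countably_piecewise (P : piecewise) : Prop :=
  exists C : set (pindex P),
    countable C /\ forall i, exists2 j, C j & piece_le i j.

Definition germ_eq (P : piecewise) (u v : {i : pindex P & hquot (piece i)}) :=
  exists (k : pindex P)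
    (hu : piece_le (projT1 u) k) (hv : piece_le (projT1 v) k),
    transition hu (projT2 u) = transition hv (projT2 v).

Definition dlim (P : piecewise) : Type := classes setT (@germ_eq P).

Definition dlim_in (P : piecewise) (i : pindex P) (x : hquot (piece i)) :
    dlim P :=
  exist _ (germ_eq (existT _ i x)) (ex_intro2 _ _ (existT _ i x) I erefl).
Arguments dlim_in {P} i x.

Definition pw_bigwedge (A : param_set) (P : piecewise) (D : set (dlim P)) :=
  forall i : pindex P, bigwedge A (preim1 [set x | D (dlim_in i x)]).

Definition in_piece (P : piecewise) (D : set (dlim P)) : Prop :=
  exists i : pindex P, D `<=` range (dlim_in i).

Definition logic_open (P : piecewise) (A : param_set) : set (set (dlim P)) :=
  [set U | pw_bigwedge A (~` U)].

Definition logic_topology (P : piecewise) (tau : set (set (dlim P))) : Prop :=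
  exists A, [/\ small_param_set A, piecewise_over A P & tau = @logic_open P A].

Definition T1_topology (T : Type) (tau : set (set T)) : Prop :=
  forall x y : T, x <> y -> exists U, [/\ tau U, U x & ~ U y].

Definition global_logic_topology (P : piecewise) (tau : set (set (dlim P))) :=
  logic_topology tau /\ T1_topology tau.

Definition locally_hyperdefinable (P : piecewise) : Prop :=
  exists A, [/\ small_param_set A, piecewise_over A P &
    forall x : dlim P, exists N U : set (dlim P),
      [/\ pw_bigwedge A N, in_piece N, @logic_open P A U, U x & U `<=` N]].

(* HB's Group also packs a choice structure on the carrier, which exists
   classically on any type. *)
Record pw_group := PwGroup {
  pw_univ :> piecewise;
  pw_group_class : Group (dlim pw_univ)
}.

Definition pw_groupType (G : pw_group) : groupType :=
  @Group.Pack (dlim G) (pw_group_class G).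

Definition pw_mul (G : pw_group) (x y : dlim G) : dlim G :=
  ((x : pw_groupType G) * (y : pw_groupType G))%g.

Definition pw_inv (G : pw_group) (x : dlim G) : dlim G :=
  ((x : pw_groupType G)^-1)%g.

Definition pw_group_over (A : param_set) (G : pw_group) : Prop :=
  [/\ piecewise_over A G,
      forall i j : pindex G, exists k : pindex G, forall x y,
        range (dlim_in k) (pw_mul (dlim_in i x) (dlim_in j y)),
      forall i : pindex G, exists j : pindex G, forall x,
        range (dlim_in j) (pw_inv (dlim_in i x)),
      forall i j k : pindex G, bigwedge A (preim3 (fun x y z =>
        pw_mul (dlim_in i x) (dlim_in j y) = dlim_in k z)) &
      forall i j : pindex G, bigwedge A (preim2 (fun x y =>
        pw_inv (dlim_in i x) = dlim_in j y))].

Definition piecewise_hyperdefinable_group (G : pw_group) : Prop :=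
  exists A, small_param_set A /\ pw_group_over A G.

End Hyperdefinable.

Definition is_topology (T : Type) (tau : set (set T)) : Prop :=
  [/\ tau setT, setI_closed tau &
      forall (I : Type) (f : I -> set T), (forall i, tau (f i)) ->
        tau (\bigcup_i f i)].

Section Space.
Variables (T : Type) (tau : set (set T)) (tauP : is_topology tau).

Definition tau_space : Type := let _ := tauP in T.

HB.instance Definition _ := gen_eqMixin tau_space.
HB.instance Definition _ := gen_choiceMixin tau_space.

Let tauT : tau setT. Proof. by case: tauP. Qed.
Let tauI : setI_closed tau. Proof. by case: tauP. Qed.
Let tauU (I : Type) (f : I -> set T) :
  (forall i, tau (f i)) -> tau (\bigcup_i f i).
Proof. by case: tauP => _ _; exact. Qed.

HB.instance Definition _ :=
  @isOpenTopological.Build tau_space tau tauT tauI tauU.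

Lemma tau_space_openE : @open tau_space = tau.
Proof. by []. Qed.

End Space.

Definition locally_compact_group (L : language) (M : structure L) (K : Type)
    (G : pw_group M K) (tau : set (set (dlim G))) : Prop :=
  exists tauP : is_topology tau,
    [/\ hausdorff_space (tau_space tauP),
        locally_compact [set: tau_space tauP],
        continuous (fun z : tau_space tauP * tau_space tauP =>
          pw_mul (G := G) z.1 z.2 : tau_space tauP) &
        continuous (fun x : tau_space tauP =>
          pw_inv (G := G) x : tau_space tauP)].

(* Main.v *)
(** Let b be a small tuple of real elements fixing the parameters A. By
    saturation and homogeneity, a type-definable set invariant under the
    automorphisms fixing b is defined by formulas over b, and these sets are
    stable under intersections, finite unions, inverse images and projections.
    All closed sets of the A-logic topology thus live over one small tuple, so
    saturation makes the pieces compact.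

    If the A-logic topology is T1, every class is invariant over A, so every
    piecewise type-definable set is closed, whatever its parameters. Two
    distinct classes in X/E are contained in complementary sets S and ~S
    definable over b; the E-saturations of ~S and S are closed, cover X/E and
    miss one class each. This separates points of a piece, and local
    hyperdefinability carries separation and compactness over to the limit.
    Multiplication is continuous because its graph is type-definable.

    Conversely, pieces are closed, so in the countable case Baire's theorem for
    locally compact Hausdorff spaces gives a piece with nonempty interior, and
    translating it puts a neighbourhood of every point inside a piece. *)
From Stdlib Require List.
Require Import Defs.
From mathcomp Require Import all_boot all_classical all_analysis.
Import Defs.

Set Implicit Arguments.
Unset Strict Implicit.
Unset Printing Implicit Defensive.

Local Open Scope classical_set_scope.

Lemma finite_set_list (T : Type) (A : set T) :
  finite_set A -> exists s : list T, forall x, A x <-> List.In x s.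
Proof.
move=> finA.
have /(@finite_seqP {classic T})[s As] : @finite_set {classic T} A by [].
exists s => x; rewrite As /=.
elim: s {As} => [|y s IH] /=; first by rewrite in_nil.
rewrite in_cons; split.
- case/orP => [/eqP ->|/IH]; [by left | by right].
- by case=> [->|/IH ->]; rewrite ?eqxx ?orbT.
Qed.

(** * Formulas and saturation *)

Section Formulas.
Variable L : language.
Implicit Types V W : ctx L.

(** Values are terms of the prescribed sort, so agreement of sorts is part of the type. *)
Definition rename V W := forall v : var V, term W (vsort v).

Fixpoint tsubst V W (f : rename V W) s (t : term V s) : term W s :=
  match t with
  | Var v => f v
  | App g ts => App (fun i => tsubst f (ts i))
  end.

Definition weaken V s : rename V (ctx_snoc V s) :=
  fun v => @Var _ (ctx_snoc V s) (Some v).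

Definition rename_snoc V W (f : rename V W) s :
    rename (ctx_snoc V s) (ctx_snoc W s) :=
  fun o => match o with
  | Some v => tsubst (@weaken W s) (f v)
  | None => @Var _ (ctx_snoc W s) None
  end.

(** The target context comes after the recursive argument because the binder case enlarges both
    contexts. *)
Fixpoint fsubst V (p : formula V) : forall W, rename V W -> formula W :=
  match p with
  | Fbot => fun W _ => Fbot W
  | Feq s t u => fun W f => Feq (tsubst f t) (tsubst f u)
  | Frel r ts => fun W f => Frel (fun i => tsubst f (ts i))
  | Fimp p q => fun W f => Fimp (fsubst p f) (fsubst q f)
  | Fall s p => fun W f => Fall (fsubst p (rename_snoc f (s := s)))
  end.

Definition Fnot V (p : formula V) := Fimp p (Fbot V).
Definition Fand V (p q : formula V) := Fnot (Fimp p (Fnot q)).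
Definition Ftrue V : formula V := Fnot (Fbot V).

Definition Fconj V (s : list (formula V)) : formula V :=
  List.fold_right (@Fand V) (Ftrue V) s.

Definition rename_l V W : rename V (ctx_cat V W) :=
  fun v => @Var _ (ctx_cat V W) (inl v).
Definition rename_r V W : rename W (ctx_cat V W) :=
  fun w => @Var _ (ctx_cat V W) (inr w).
Definition rename_case V W Z (f : rename V Z) (g : rename W Z) :
    rename (ctx_cat V W) Z :=
  fun u => match u with inl v => f v | inr w => g w end.
Definition rename_id V : rename V V := fun v => Var v.
Definition rename_comp V W Z (f : rename V W) (g : rename W Z) : rename V Z :=
  fun v => tsubst g (f v).

Variable M : structure L.

(** Substitutions act contravariantly on tuples; coordinate projections, swaps and updates are all
    instances. *)
Definition pull V W (f : rename V W) (a : tuple_of M W) : tuple_of M V :=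
  fun v => term_eval a (f v).

Lemma term_eval_subst V W (f : rename V W) (a : tuple_of M W) s
    (t : term V s) :
  term_eval a (tsubst f t) = term_eval (pull f a) t.
Proof.
elim: t => //= g ts IH; congr (finterp _).
by apply: functional_extensionality_dep => i; exact: IH.
Qed.

Lemma pull_comp V W Z (f : rename V W) (g : rename W Z) (a : tuple_of M Z) :
  pull (rename_comp f g) a = pull f (pull g a).
Proof.
by apply: functional_extensionality_dep => v; exact: term_eval_subst.
Qed.

Lemma pull_snoc V W (f : rename V W) (a : tuple_of M W) s (m : M s) :
  pull (rename_snoc f (s := s)) (tuple_snoc a m) = tuple_snoc (pull f a) m.
Proof.
apply: functional_extensionality_dep => -[v|] //=.
by rewrite /pull /= term_eval_subst.
Qed.

Lemma holds_subst V (p : formula V) W (f : rename V W) (a : tuple_of M W) :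
  holds_at (fsubst p f) a <-> holds_at p (pull f a).
Proof.
elim: p W f a => {V} //= [V s t u|V r ts|V p IHp q IHq|V s p IH] W f a.
- by rewrite !term_eval_subst.
- suff -> : (fun i => term_eval a (tsubst f (ts i))) =
            (fun i => term_eval (pull f a) (ts i)) by [].
  by apply: functional_extensionality_dep => i; exact: term_eval_subst.
- by rewrite IHp IHq.
- by split=> H m; move: (H m); rewrite IH pull_snoc.
Qed.

Lemma holds_not V (p : formula V) (a : tuple_of M V) :
  holds_at (Fnot p) a <-> ~ holds_at p a.
Proof. by []. Qed.

Lemma holds_and V (p q : formula V) (a : tuple_of M V) :
  holds_at (Fand p q) a <-> holds_at p a /\ holds_at q a.
Proof.
split=> [H|[pa qa] H]; last exact: H.
by split; apply: contrapT => n; apply: H => pa // qa; exact: n.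
Qed.

Lemma holds_conj V (s : list (formula V)) (a : tuple_of M V) :
  holds_at (Fconj s) a <-> forall p, List.In p s -> holds_at p a.
Proof.
elim: s => [|q s IH]; first by split=> // _; rewrite /= => x; exact: x.
rewrite holds_and IH; split=> [[qa sa] p /= [<-//|]|H]; first exact: sa.
by split; [apply: H; left | move=> p ps; apply: H; right].
Qed.

Lemma pull_case V W Z (f : rename V Z) (g : rename W Z) (a : tuple_of M Z) :
  pull (rename_case f g) a = tuple_cat (pull f a) (pull g a).
Proof. by apply: functional_extensionality_dep => -[]. Qed.

Lemma pull_l V W (a : tuple_of M V) (b : tuple_of M W) :
  pull (@rename_l V W) (tuple_cat a b) = a.
Proof. exact: functional_extensionality_dep. Qed.

Lemma pull_r V W (a : tuple_of M V) (b : tuple_of M W) :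
  pull (@rename_r V W) (tuple_cat a b) = b.
Proof. exact: functional_extensionality_dep. Qed.

Lemma pull_id V (a : tuple_of M V) : pull (@rename_id V) a = a.
Proof. exact: functional_extensionality_dep. Qed.

Lemma tuple_cat_inj V W (a a' : tuple_of M V) (b b' : tuple_of M W) :
  tuple_cat a b = tuple_cat a' b' -> a = a' /\ b = b'.
Proof.
by move=> e; split; [move: (congr1 (pull (@rename_l V W)) e); rewrite !pull_l
  |move: (congr1 (pull (@rename_r V W)) e); rewrite !pull_r].
Qed.

Lemma aut_term (g : automorphism M) V (a : tuple_of M V) s (t : term V s) :
  term_eval (aut_tuple g a) t = g _ (term_eval a t).
Proof.
elim: t => //= f ts IH; rewrite aut_fun; congr (finterp _).
by apply: functional_extensionality_dep => i; exact: IH.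
Qed.

Lemma aut_snoc (g : automorphism M) V (a : tuple_of M V) s (m : M s) :
  aut_tuple g (tuple_snoc a m) = tuple_snoc (aut_tuple g a) (g _ m).
Proof. by apply: functional_extensionality_dep => -[]. Qed.

Lemma aut_cat (g : automorphism M) V W (a : tuple_of M V) (b : tuple_of M W) :
  aut_tuple g (tuple_cat a b) = tuple_cat (aut_tuple g a) (aut_tuple g b).
Proof. by apply: functional_extensionality_dep => -[]. Qed.

Lemma aut_pull (g : automorphism M) V W (f : rename V W) (a : tuple_of M W) :
  pull f (aut_tuple g a) = aut_tuple g (pull f a).
Proof. by apply: functional_extensionality_dep => v; exact: aut_term. Qed.

Lemma aut_holds (g : automorphism M) V (p : formula V) (a : tuple_of M V) :
  holds_at p (aut_tuple g a) <-> holds_at p a.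
Proof.
elim: p a => {V} //= [V s t u|V r ts|V p IHp q IHq|V s p IH] a.
- rewrite !aut_term; split=> [|-> //]; exact: (bij_inj (aut_bij g s)).
- suff -> : (fun i => term_eval (aut_tuple g a) (ts i)) =
            (fun i => g _ (term_eval a (ts i))) by exact: aut_rel.
  by apply: functional_extensionality_dep => i; exact: aut_term.
- by rewrite IHp IHq.
- split=> H m; first by rewrite -IH aut_snoc; exact: H.
  by have [h _ gh] := aut_bij g s; rewrite -(gh m) -aut_snoc IH; exact: H.
Qed.

(** Contexts may be infinite but arities are finite, so only finitely many variables occur. *)
Lemma term_support V s (t : term V s) : exists2 D : set (var V), finite_set D &
  forall a a' : tuple_of M V, (forall v, D v -> a v = a' v) ->
    term_eval a t = term_eval a' t.
Proof.
elim: t => [v|f ts IH]; first by exists [set v] => // a a' /=; apply.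
pose D i := sval (cid2 (IH i)).
exists (\bigcup_(i in [set: 'I_(far f)]) D i) => [|a a' aa'] /=.
  by apply: bigcup_finite => // i _; rewrite /D; case: cid2.
congr (finterp _); apply: functional_extensionality_dep => i.
have : D i `<=` \bigcup_(i in [set: 'I_(far f)]) D i by move=> v Dv; exists i.
by rewrite /D; case: cid2 => D' _ H /= sub; apply: H => v /sub; exact: aa'.
Qed.

Lemma formula_support V (p : formula V) :
  exists2 D : set (var V), finite_set D &
  forall a a' : tuple_of M V, (forall v, D v -> a v = a' v) ->
    (holds_at p a <-> holds_at p a').
Proof.
elim: p => {V} [V|V s t u|V r ts|V p [D fD HD] q [D' fD' HD']|V s p [D fD HD]].
- by exists set0.
- have [D fD HD] := term_support t; have [D' fD' HD'] := term_support u.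
  exists (D `|` D') => [|a a' aa' /=]; first by rewrite finite_setU.
  by rewrite (HD a a') ?(HD' a a')// => v Dv; apply: aa'; [right|left].
- pose D i := sval (cid2 (term_support (ts i))).
  exists (\bigcup_(i in [set: 'I_(rar r)]) D i) => [|a a' aa'] /=.
    by apply: bigcup_finite => // i _; rewrite /D; case: cid2.
  suff -> : (fun i => term_eval a (ts i)) = (fun i => term_eval a' (ts i))
    by [].
  apply: functional_extensionality_dep => i.
  have : D i `<=` \bigcup_(i in [set: 'I_(rar r)]) D i by move=> v Dv; exists i.
  by rewrite /D; case: cid2 => D' _ H /= sub; apply: H => v /sub; exact: aa'.
- exists (D `|` D') => [|a a' aa' /=]; first by rewrite finite_setU.
  by rewrite (HD a a') ?(HD' a a')// => v Dv; apply: aa'; [right|left].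
(* The quantified variable [None] is dropped from the support of the body. *)
- exists (Some @^-1` D) => [|a a' aa' /=].
    by apply: finite_preimage => // x y _ _ [].
  have e m : holds_at p (tuple_snoc a m) <-> holds_at p (tuple_snoc a' m).
    by apply: HD => -[v|//] Dv /=; rewrite aa'.
  by split=> H m; apply/e.
Qed.

Definition upd V (a : tuple_of M V) (v : var V) (m : M (vsort v)) :
    tuple_of M V :=
  fun w => match pselect (v = w) with
  | left e => ecast w (M (vsort w)) e m
  | right _ => a w
  end.

Lemma upd_same V (a : tuple_of M V) v (m : M (vsort v)) : upd a m v = m.
Proof.
rewrite /upd; case: pselect => // e.
by rewrite (Prop_irrelevance e erefl).
Qed.

Lemma upd_other V (a : tuple_of M V) v (m : M (vsort v)) w :
  v <> w -> upd a m w = a w.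
Proof. by rewrite /upd; case: pselect. Qed.

(** The syntactic form of [upd]: the fresh variable takes the place of [v], and the others become
    parameters. *)
Definition rename_upd V (v : var V) : rename V (ctx_snoc V (vsort v)) :=
  fun w => match pselect (v = w) with
  | left e => ecast w (term (ctx_snoc V (vsort v)) (vsort w)) e
      (@Var _ (ctx_snoc V (vsort v)) None)
  | right _ => @Var _ (ctx_snoc V (vsort v)) (Some w)
  end.

Lemma pull_upd V (v : var V) (a : tuple_of M V) (m : M (vsort v)) :
  pull (rename_upd v) (tuple_snoc a m) = upd a m.
Proof.
apply: functional_extensionality_dep => w; rewrite /pull /rename_upd /upd.
by case: pselect => //= e; case: _ / e.
Qed.

(** The variables of [l] are quantified existentially one at a time, each existential being a
    negated universal. *)
Lemma exists_variant (V : ctx L) (p : formula V) (l : list (var V)) :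
  exists q : formula V, forall a : tuple_of M V,
    holds_at q a <->
    exists2 a', holds_at p a' & forall w, ~ List.In w l -> a' w = a w.
Proof.
elim: l => [|v l [q Hq]] /=.
  exists p => a; split=> [pa|[a' pa' aa']]; first by exists a.
  suff -> : a = a' by [].
  by apply: functional_extensionality_dep => w; rewrite aa'.
exists (Fnot (Fall (fsubst (Fnot q) (rename_upd v)))) => a.
rewrite holds_not /=; split=> [H|[a' pa' aa'] H].
- apply: contrapT => H'; apply: H => m.
  rewrite holds_subst pull_upd Hq => -[a' pa' aa'].
  apply: H'; exists a' => // w; move=> /not_orP[vw wl].
  by rewrite aa'// upd_other.
- apply: (H (a' v)); rewrite holds_subst pull_upd Hq; exists a' => // w wl.
  have [->|vw] := pselect (v = w).
    by rewrite upd_same.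
  by rewrite upd_other// aa'//; case.
Qed.

End Formulas.

(** * Comparison of cardinals *)

(** Zorn's lemma gives a maximal graph of a partial injection; if it missed a point on each side,
    that pair could be added. *)
Lemma card_le_total (T U : Type) :
  ([set: T] #<= [set: U])%card \/ ([set: U] #<= [set: T])%card.
Proof.
pose P (R : set (T * U)) := forall x y, R x -> R y -> (x.1 = y.1 <-> x.2 = y.2).
have [F FP totF|R [PR maxR]] := @Zorn_bigcup _ P.
  move=> x y [X FX Xx] [Y FY Yy].
  by have [XY|YX] := totF _ _ FX FY;
    [apply: (FP _ FY) => //; exact: XY | apply: (FP _ FX) => //; exact: YX].
have [domR|ndomR] := pselect (forall t, exists u, R (t, u)).
  left; have [f Rf] := choice domR.
  have fi : {in [set: T] &, injective f}.
    by move=> s t _ _ st; apply/(PR _ _ (Rf s) (Rf t)).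
  apply: card_le_trans (card_leT (f @` setT)).
  by move: (inj_card_eq fi); rewrite card_eq_sym card_eq_le => /andP[].
have [ranR|nranR] := pselect (forall u, exists t, R (t, u)).
  right; have [f Rf] := choice ranR.
  have fi : {in [set: U] &, injective f}.
    by move=> s t _ _ st; apply/(PR _ _ (Rf s) (Rf t)).
  apply: card_le_trans (card_leT (f @` setT)).
  by move: (inj_card_eq fi); rewrite card_eq_sym card_eq_le => /andP[].
move/existsNP: ndomR => [t Nt]; move/existsNP: nranR => [u Nu].
exfalso; apply: (maxR (R `|` [set (t, u)])).
  split; first by move=> x; left.
  by move=> sub; apply: Nt; exists u; apply: sub; right.
move=> [x1 x2] [y1 y2] [Rx|[-> ->]] [Ry|[-> ->]] /=;
  first exact: (PR _ _ Rx Ry).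
- by split=> e;
    [case: Nt; exists x2; rewrite -e|case: Nu; exists x1; rewrite -e].
- by split=> e;
    [case: Nt; exists y2; rewrite e|case: Nu; exists y1; rewrite e].
- by [].
Qed.

Lemma injective_card_le (T U : Type) (f : T -> U) :
  injective f -> ([set: T] #<= [set: U])%card.
Proof.
move=> fi; apply: card_le_trans (card_leT (f @` setT)).
have : {in [set: T] &, injective f} by move=> x y _ _; exact: fi.
by move=> /inj_card_eq; rewrite card_eq_sym card_eq_le => /andP[].
Qed.

Lemma card_le_injective (T U : Type) :
  ([set: T] #<= [set: U])%card -> exists f : T -> U, injective f.
Proof.
move=> /card_leP[f].
pose i (x : T) : [set: T] := exist _ x (mem_set I).
exists (fun x => val (f (i x))) => x y /val_inj fxy.
have /(congr1 val) // : i x = i y.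
by apply: (@inj _ _ _ f) => //; rewrite inE.
Qed.

Lemma card_lt_le (T U K : Type) :
  ([set: T] #<= [set: U])%card -> card_lt U K -> card_lt T K.
Proof.
move=> TU [UK nKU]; split; first exact: card_le_trans UK.
by move=> KT; apply: nKU; exact: card_le_trans TU.
Qed.

(** The sum embeds into the double power set of the larger summand, which stays below [K] by two
    uses of the strong limit hypothesis. *)
Lemma card_lt_sum (K T U : Type) : strong_limit K ->
  card_lt T K -> card_lt U K -> card_lt (T + U) K.
Proof.
move=> [_ Kpow].
wlog TU : T U / ([set: T] #<= [set: U])%card.
  move=> wl TK UK; have [TU|UT] := card_le_total T U; first exact: wl.
  apply: card_lt_le (wl _ _ UT UK TK).
  by apply: (@injective_card_le _ _ (fun x => match x with
    inl a => inr a | inr a => inl a end)) => -[x|x] [y|y] // [->].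
move=> _ UK; have [f fi] := card_le_injective TU.
apply: card_lt_le (Kpow _ (Kpow _ UK)).
(* The empty set as a member marks the right summand. *)
pose h (x : T + U) : set (set U) := match x with
  | inl t => [set [set f t]] | inr u => [set [set u]; set0] end.
have s1 (a b : U) : [set a] = [set b] -> a = b.
  by move=> e; have : [set b] a by rewrite -e.
apply: (@injective_card_le _ _ h) => -[x|x] [y|y] /= e.
- have : [set [set f y]] [set f x] by rewrite -e.
  by move/s1/fi ->.
- have : [set [set f x]] set0 by rewrite e; right.
  by move=> /= e'; have : set0 (f x) by rewrite e'.
- have : [set [set f y]] set0 by rewrite -e; right.
  by move=> /= e'; have : set0 (f y) by rewrite e'.
- have : [set [set y]; set0] [set x] by rewrite -e; left.
  move=> [/s1 ->//|e']; have : set0 x by rewrite -e'.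
  by [].
Qed.

(** * Compactness for tuples in small contexts *)

Section Compactness.
Variables (L : language) (M : structure L) (K : Type).
Hypothesis M_saturated : saturated M K.

(** [B] may be infinite, but only its finite part inside the support of [p] has to be quantified. *)
Lemma exists_variant_set (V : ctx L) (p : formula V) (B : set (var V)) :
  exists q : formula V, forall a : tuple_of M V,
    holds_at q a <->
    exists2 a', holds_at p a' & forall w, ~ B w -> a' w = a w.
Proof.
have [D fD Dp] := formula_support M p.
have [l lP] : exists l, forall w, (D `&` B) w <-> List.In w l.
  by apply: finite_set_list; exact: finite_setIl.
have [q qP] := exists_variant M p l.
exists q => a; rewrite qP; split=> -[a' pa' aa'].
  by exists a' => // w Bw; apply: aa' => /lP -[].
exists (fun w => if pselect (B w) then if pselect (D w) then a' w else a w
                 else a w).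
  apply/(Dp _ a'); last exact: pa'.
  move=> v Dv; case: pselect => Bv; last by rewrite aa'//; case.
  by case: pselect.
move=> w; rewrite -lP => nDB.
by case: pselect => // Bw; case: pselect => // Dw; case: nDB.
Qed.

Definition agrees (V : ctx L) (C : set {v : var V & M (vsort v)})
    (a : tuple_of M V) := forall x, C x -> a (projT1 x) = projT2 x.

Section Extension.
Variables (V : ctx L) (C0 : set {v : var V & M (vsort v)}).
Variable Phi : set (formula V).

(** [C0] holds prescribed values, fixed throughout; [C] is the partial assignment that Zorn's lemma
    enlarges. *)
Definition consistent_with (C : set {v : var V & M (vsort v)}) :=
  forall s : list (formula V), (forall p, List.In p s -> Phi p) ->
  exists a : tuple_of M V,
    [/\ agrees C0 a, agrees C a & forall p, List.In p s -> holds_at p a].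

Lemma consistent_functional C v (m m' : M (vsort v)) : consistent_with C ->
  C (existT _ v m) -> C (existT _ v m') -> m = m'.
Proof.
move=> /(_ nil) [//|a [_ aC _]] Cm Cm'.
by have /= <- := aC _ Cm; have /= <- := aC _ Cm'.
Qed.

(** Finitely many formulas mention finitely many variables, so one member of the chain already
    contains every value that the union gives to these; [set0] serves if there is none. *)
Lemma consistent_bigcup (F : set (set {v : var V & M (vsort v)})) :
  consistent_with set0 -> F `<=` consistent_with -> total_on F subset ->
  consistent_with (\bigcup_(X in F) X).
Proof.
move=> cons0 consF totF; set U := \bigcup_(X in F) X.
have funU v (m m' : M (vsort v)) :
    U (existT _ v m) -> U (existT _ v m') -> m = m'.
  move=> [X FX Xm] [Y FY Ym'].
  by have [XY|YX] := totF _ _ FX FY;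
    [apply: (consistent_functional (consF _ FY)) => //; exact: XY
    |apply: (consistent_functional (consF _ FX)) => //; exact: YX].
move=> s sPhi; have [D fD Dp] := formula_support M (Fconj s).
have [l lP] := finite_set_list fD.
have [C [CF _ CU]] : exists C, [/\ C = set0 \/ F C, consistent_with C &
    forall x, U x -> List.In (projT1 x) l -> C x].
  elim: {lP} l => [|v l [C [CF consC CU]]].
    by exists set0; split=> //; left.
  have [[m [X FX Xm]]|nU] := pselect (exists m, U (existT _ v m)); last first.
    exists C; split=> // -[w m] /= Um [e|]; last exact: (CU (existT _ w m)).
    by case: nU; case: _ / e m Um => m Um; exists m.
  have XU (Y : set _) : X `<=` Y -> forall x, U x -> projT1 x = v -> Y x.
    move=> XY [w k] /= + e; case: _ / (esym e) k => k Uk.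
    by apply: XY; rewrite (funU v k m Uk)//; exists X.
  have [CX|XC] : C `<=` X \/ X `<=` C.
    by case: CF => [->|FC]; [left|exact: totF].
  - exists X; split; [by right|exact: consF|].
    by move=> x Ux [e|xl]; [exact: (XU X)|apply: CX; exact: CU].
  - by exists C; split=> // x Ux [e|xl]; [exact: (XU C)|exact: CU].
have consC : consistent_with C by case: CF => [->|/consF].
have [a [aC0 aC sa]] := consC s sPhi.
(* Overriding [a] by the union changes nothing on the support of [s]: the values there belong to
   [C], with which [a] agrees. *)
pose b : tuple_of M V := fun v =>
  match pselect (exists m, U (existT _ v m)) with
  | left e => sval (cid e) | right _ => a v end.
have bU : agrees U b.
  move=> [v m] /= Um; rewrite /b; case: pselect => [e|[]]; last by exists m.
  by case: cid => m' /= Um'; exact: funU Um' Um.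
exists b; split=> //.
  move=> [v m] /= C0m; rewrite /b; case: pselect => [e|_]; last exact: aC0 C0m.
  case: cid => m' /= [X FX Xm'].
  have [//|a' [a'C0 a'X _]] := consF _ FX nil.
  by have /= <- := a'X _ Xm'; have /= <- := a'C0 _ C0m.
apply/holds_conj/(Dp _ a); last exact/holds_conj.
move=> v /lP vl; rewrite /b; case: pselect => // e; case: cid => m /= Um.
exact: esym (aC _ (CU _ Um vl)).
Qed.

(** Saturation handles one variable at a time. It shows that a maximal consistent partial assignment
    leaves no variable without a value. *)
Lemma compactness : small K (var V) -> consistent_with set0 ->
  exists a : tuple_of M V, agrees C0 a /\ forall p, Phi p -> holds_at p a.
Proof.
move=> smallV cons0.
have [F consF totF|C [consC maxC]] := @Zorn_bigcup _ consistent_with.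
  exact: consistent_bigcup.
(* [f] supplies the parameters; its values at unassigned variables do not matter, as these variables
   get quantified or replaced. *)
have [//|f [fC0 fC _]] := consC nil.
have domC v : (exists m, C0 (existT _ v m)) \/ (exists m, C (existT _ v m)).
  apply: contrapT => /not_orP[nC0 nC].
  (* [B] collects the unassigned variables other than [v], and [defines q p] says that [q] is [p]
     quantified existentially over them. *)
  pose B w := [/\ w <> v, ~ (exists m, C0 (existT _ w m)) &
                  ~ (exists m, C (existT _ w m))].
  pose defines (q p : formula V) := forall a : tuple_of M V, holds_at q a <->
    exists2 a', holds_at p a' & forall w, ~ B w -> a' w = a w.
  (* f and m satisfy Psi iff mapping v to m keeps Phi finitely satisfiable. *)
  pose Psi : set (formula (ctx_snoc V (vsort v))) := [set r | exists s q,
    [/\ forall p, List.In p s -> Phi p, defines q (Fconj s) &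
        r = fsubst q (rename_upd v)]].
  have [|m Psim] := M_saturated (b := f) (Phi := Psi) smallV.
    move=> F finF FPsi; have [l lP] := finite_set_list finF.
    have {FPsi} lPsi r : List.In r l -> Psi r by move/lP/FPsi.
    (* Finitely many members of [Psi] arise from one finite part [s] of [Phi]; if [a] extends the
       assignments and realises [s], then [a v] satisfies them all. *)
    have [s [sPhi sP]] : exists s, (forall p, List.In p s -> Phi p) /\
        forall r, List.In r l -> forall a : tuple_of M V,
        agrees C0 a -> agrees C a -> (forall p, List.In p s -> holds_at p a) ->
        holds_at r (tuple_snoc f (a v)).
      elim: l {lP} lPsi => [|r l IH] lPsi; first by exists nil.
      have [r' r'l|s [sPhi sP]] := IH; first by apply: lPsi; right.
      have [s' [q [s'Phi qs' re]]] := lPsi r (or_introl erefl).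
      exists (app s s'); split=> [p ps|].
        by case: (List.in_app_or _ _ _ ps) => [/sPhi|/s'Phi].
      move=> r' [<-|r'l] a aC0 aC sa; last first.
        by apply: sP => // p ps; apply: sa; apply: List.in_or_app; left.
      rewrite re holds_subst pull_upd; apply/qs'; exists a.
        by apply/holds_conj => p ps; apply: sa; apply: List.in_or_app; right.
      move=> w nB; have [<-|vw] := pselect (v = w); first by rewrite upd_same.
      rewrite upd_other//.
      have [[k C0k]|nC0w] := pselect (exists m, C0 (existT _ w m)).
        by have /= -> := aC0 _ C0k; have /= -> := fC0 _ C0k.
      have [[k Ck]|nCw] := pselect (exists m, C (existT _ w m)).
        by have /= -> := aC _ Ck; have /= -> := fC _ Ck.
      by case: nB; split=> // e; exact: vw.
    have [a [aC0 aC sa]] := consC s sPhi.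
    by exists (a v) => r /lP rl; exact: sP.
  apply: (maxC (C `|` [set existT _ v m])).
    split; first by move=> x; left.
    by move=> sub; apply: nC; exists m; apply: sub; right.
  move=> s sPhi; have [q qs] := exists_variant_set (Fconj s) B.
  have : holds_at (fsubst q (rename_upd v)) (tuple_snoc f m).
    by apply: Psim; exists s, q.
  rewrite holds_subst pull_upd qs => -[a sa af].
  exists a; split; last exact/holds_conj.
  - move=> [w k] /= C0k; have vw : v <> w.
      by move=> e; apply: nC0; subst w; exists k.
    by rewrite af ?upd_other//; [exact: fC0 C0k|case=> _ []; exists k].
  - move=> [w k] /= [Ck|e].
      have vw : v <> w.
        by move=> e; apply: nC; subst w; exists k.
      by rewrite af ?upd_other//; [exact: fC Ck|case=> _ _ []; exists k].
    rewrite -[w]/(projT1 (existT (fun v => M (vsort v)) w k)).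
    rewrite -[k in RHS]/(projT2 (existT (fun v => M (vsort v)) w k)) e /=.
    by rewrite af ?upd_same//; case.
(* Every variable now has a value, so [f] is the only tuple that agrees with both [C0] and [C]. *)
exists f; split=> // p Phip.
have [q [<-//|//]|a [aC0 aC pa]] := consC (cons p nil).
suff <- : a = f by apply: pa; left.
apply: functional_extensionality_dep => v.
have [[m mC]|[m mC]] := domC v.
  by have /= -> := aC0 _ mC; have /= -> := fC0 _ mC.
by have /= -> := aC _ mC; have /= -> := fC _ mC.
Qed.

End Extension.
End Compactness.

(** * Sets definable over a tuple *)

Section DefinableOver.
Variables (L : language) (M : structure L).

Definition definable_over (W : ctx L) (b : tuple_of M W) (V : ctx L)
    (S : set (tuple_of M V)) :=
  exists Phi : set (formula (ctx_cat V W)), forall a,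
    S a <-> forall p, Phi p -> holds_at p (tuple_cat a b).

Definition invariant_over (W : ctx L) (b : tuple_of M W) (V : ctx L)
    (S : set (tuple_of M V)) :=
  forall g : automorphism M, aut_tuple g b = b -> aut_stable g S.

Section Closure.
Variables (W : ctx L) (b : tuple_of M W).
Local Notation defb := (definable_over b).

Lemma definable_over_invariant V (S : set (tuple_of M V)) :
  defb S -> invariant_over b S.
Proof.
move=> [Phi SP] g gb a; rewrite !SP.
have e p : holds_at p (tuple_cat (aut_tuple g a) b) <->
           holds_at p (tuple_cat a b).
  by rewrite -{1}gb -aut_cat aut_holds.
by split=> H p /H /e.
Qed.

Lemma definable_over_formula V (p : formula (ctx_cat V W)) :
  defb [set a | holds_at p (tuple_cat a b)].
Proof. by exists [set p] => a; split=> [H q ->//|]; apply. Qed.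

(** Taking every formula over [b] that is valid on some member avoids choosing a defining set for
    each. *)
Lemma definable_over_forall V (FF : set (set (tuple_of M V))) :
  (forall S, FF S -> defb S) -> defb [set a | forall S, FF S -> S a].
Proof.
move=> FFdef.
exists [set p | exists2 S, FF S & forall a, S a -> holds_at p (tuple_cat a b)].
move=> a; split=> [aFF p [S FFS]|H S FFS]; first by apply; exact: aFF.
have [Phi SP] := FFdef S FFS; apply/SP => p Phip; apply: H; exists S => // c.
by move=> /SP; exact.
Qed.

Lemma definable_overI V (S S' : set (tuple_of M V)) :
  defb S -> defb S' -> defb (S `&` S').
Proof.
move=> dS dS'.
rewrite (_ : S `&` S' = [set a | forall T, [set S; S'] T -> T a]).
  by apply: definable_over_forall => T [->|->].
apply/seteqP; split=> a /=; first by move=> [Sa S'a] T [->|->].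
by move=> H; split; apply: H; [left|right].
Qed.

Lemma definable_over0 V : defb (@set0 (tuple_of M V)).
Proof. by exists [set (Fbot _)] => a; split=> // H; apply: (H _ erefl). Qed.

(** A point outside both sets fails some [p] valid on the first and some [p'] valid on the second,
    hence their disjunction, which is valid on the union. *)
Lemma definable_overU V (S S' : set (tuple_of M V)) :
  defb S -> defb S' -> defb (S `|` S').
Proof.
move=> [Phi SP] [Phi' SP'].
exists [set p | forall a, (S `|` S') a -> holds_at p (tuple_cat a b)] => a.
split=> [Sa p|H]; first exact.
apply: contrapT => /not_orP[nS nS'].
have [p Phip np] : exists2 p, Phi p & ~ holds_at p (tuple_cat a b).
  by apply: contrapT => N; apply: nS; apply/SP => p Phip; apply: contrapT => ?;
    apply: N; exists p.
have [p' Phip' np'] : exists2 p, Phi' p & ~ holds_at p (tuple_cat a b).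
  by apply: contrapT => N; apply: nS'; apply/SP' => p' Phip';
    apply: contrapT => ?; apply: N; exists p'.
apply: np'; apply: (H (Fimp (Fnot p) p')) => // c [/SP Sc|/SP' S'c] /= n.
  by exfalso; apply: n; exact: Sc.
exact: S'c.
Qed.

Lemma definable_over_pull V V' (f : rename V V') (S : set (tuple_of M V)) :
  defb S -> defb [set a | S (pull f a)].
Proof.
move=> [Phi SP].
pose h : rename (ctx_cat V W) (ctx_cat V' W) :=
  rename_case (rename_comp f (@rename_l _ V' W)) (@rename_r _ V' W).
have hE (a : tuple_of M V') : pull h (tuple_cat a b) = tuple_cat (pull f a) b.
  by rewrite pull_case pull_comp pull_l pull_r.
exists [set fsubst p h | p in Phi] => a; rewrite /= SP; split.
  by move=> H _ [p Phip <-]; rewrite holds_subst hE; exact: H.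
by move=> H p Phip; rewrite -hE -holds_subst; apply: H; exists p.
Qed.

End Closure.

(** Parameters given by terms in [d] may be replaced by [d]; in particular, definability survives
    adjoining parameters. *)
Lemma definable_over_param (W W' : ctx L) (h : rename W W') (d : tuple_of M W')
    V (S : set (tuple_of M V)) :
  definable_over (pull h d) S -> definable_over d S.
Proof.
move=> [Phi SP].
pose k : rename (ctx_cat V W) (ctx_cat V W') :=
  rename_case (@rename_l _ V W') (rename_comp h (@rename_r _ V W')).
have kE (a : tuple_of M V) : pull k (tuple_cat a d) = tuple_cat a (pull h d).
  by rewrite pull_case pull_comp pull_l pull_r.
exists [set fsubst p k | p in Phi] => a; rewrite /= SP; split.
  by move=> H _ [p Phip <-]; rewrite holds_subst kE; exact: H.
by move=> H p Phip; rewrite -kE -holds_subst; apply: H; exists p.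
Qed.

Variable K : Type.
Hypothesis K_strong_limit : strong_limit K.
Hypothesis M_saturated : saturated M K.
Hypothesis M_homogeneous : strongly_homogeneous M K.

Lemma small_cat (V W : ctx L) :
  small K (var V) -> small K (var W) -> small K (var (ctx_cat V W)).
Proof. exact: card_lt_sum. Qed.

(** By directedness, finitely many formulas, each valid on some member, are all valid on one
    nonempty member, so compactness applies. *)
Lemma directed_intersection (W : ctx L) (b : tuple_of M W) (V : ctx L)
    (FF : set (set (tuple_of M V))) :
  small K (var W) -> small K (var V) -> FF !=set0 ->
  (forall S, FF S -> definable_over b S) -> (forall S, FF S -> S !=set0) ->
  (forall S S', FF S -> FF S' -> exists2 T, FF T & T `<=` S `&` S') ->
  exists a, forall S, FF S -> S a.
Proof.
move=> smallW smallV [S0 FFS0] FFdef FFne FFdir.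
(* Prescribing the values [b] on the variables of [W] makes these act as constants. *)
pose C0 : set {u : var (ctx_cat V W) & M (vsort u)} :=
  [set x | exists w,
    x = existT (fun u : var (ctx_cat V W) => M (vsort u)) (inr w) (b w)].
have agreesE (a : tuple_of M (ctx_cat V W)) :
    agrees C0 a <-> a = tuple_cat (fun v => a (inl v)) b.
  split=> [aC0|-> _ [w ->] //].
  apply: functional_extensionality_dep => -[v|w] //=.
  by apply: (aC0 (existT _ (inr w) (b w))); exists w.
pose Phi : set (formula (ctx_cat V W)) :=
  [set p | exists2 S, FF S & forall a, S a -> holds_at p (tuple_cat a b)].
have [s sPhi|a [/agreesE aE aPhi]] :=
    compactness M_saturated (C0 := C0) (Phi := Phi) (small_cat smallV smallW).
  have [S FFS SP] : exists2 S, FF S & forall a, S a ->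
      forall p, List.In p s -> holds_at p (tuple_cat a b).
    elim: s sPhi => [|p s IH] sPhi; first by exists S0.
    have [q qs|S FFS SP] := IH; first by apply: sPhi; right.
    have [S' FFS' SP'] := sPhi p (or_introl erefl).
    have [T FFT TS] := FFdir _ _ FFS FFS'.
    exists T => // a /TS[Sa S'a] q [<-|qs]; first exact: SP'.
    exact: SP.
  have [a Sa] := FFne S FFS; exists (tuple_cat a b); split=> //.
  - exact/agreesE.
  - exact: SP.
exists (fun v => a (inl v)) => S FFS; have [PhiS SP] := FFdef S FFS.
apply/SP => p pS; rewrite -aE; apply: aPhi; exists S => // c /SP; exact.
Qed.

(* A point outside the image is separated from it by a formula of its type
   over b: otherwise saturation yields a point of the image with the same type
   over b, hence conjugate to it. *)
Lemma definable_over_image (W W' : ctx L) (b : tuple_of M W)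
    (d : tuple_of M W') (V V' : ctx L) (f : rename V V')
    (R : set (tuple_of M V')) :
  small K (var W) -> small K (var W') -> small K (var V) -> small K (var V') ->
  definable_over d R -> invariant_over b (@pull _ M _ _ f @` R) ->
  definable_over b (@pull _ M _ _ f @` R).
Proof.
move=> smallW smallW' smallV smallV' dR inv; set S := _ @` _ in inv *.
exists [set p | forall a, S a -> holds_at p (tuple_cat a b)] => a.
split=> [Sa p|H]; first exact.
pose T p : set (tuple_of M V') :=
  [set x | R x /\ holds_at p (tuple_cat (pull f x) b)].
pose FF := [set T p | p in [set p | holds_at p (tuple_cat a b)]].
(* [R] lives over [d] and the conditions over [b], so the family is definable over the two
   together. *)
have [||_ [p _ <-]|_ [p pa <-]|_ _ [p pa <-] [q qa <-]|x xFF] :=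
    @directed_intersection _ (tuple_cat d b) V' FF (small_cat smallW' smallW).
- by [].
- by exists (T (Ftrue _)); exists (Ftrue _) => //= ?.
- apply: definable_overI.
    apply: (@definable_over_param _ _ (@rename_l _ W' W)).
    by rewrite pull_l.
  apply: (@definable_over_param _ _ (@rename_r _ W' W)); rewrite pull_r.
  exact: (definable_over_pull f (definable_over_formula b p)).
(* If no point of the image satisfied [p], its negation would hold on all of [S], hence at [a]. *)
- apply: contrapT => ne; have : holds_at (Fnot p) (tuple_cat a b).
    apply: H => _ [x Rx <-] /= px; apply: ne; by exists x.
  exact.
- exists (T (Fand p q)); first by exists (Fand p q) => //; apply/holds_and.
  by move=> x [Rx /holds_and[px qx]]; split; split.
have Rx : R x.
  by apply: (xFF (T (Ftrue _)) _).1; exists (Ftrue _) => //= ?.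
have [|p|g] := M_homogeneous (W := ctx_cat V W)
    (a := tuple_cat (pull f x) b) (b := tuple_cat a b).
- exact: small_cat.
- have pP q : holds_at q (tuple_cat a b) ->
      holds_at q (tuple_cat (pull f x) b).
    by move=> qa; apply: (xFF (T q) _).2; exists q.
  split; last exact: pP.
  by move=> px; apply: contrapT => /(pP (Fnot p)) /=; exact.
rewrite aut_cat => /tuple_cat_inj[<- gb].
by apply/(inv g gb); exists x.
Qed.

(** The identity substitution turns [definable_over_image] into a change of parameters, from
    arbitrary small ones to [b]. *)
Lemma definable_overP (W : ctx L) (b : tuple_of M W) (V : ctx L)
    (S : set (tuple_of M V)) : small K (var W) -> small K (var V) ->
  definable_over b S <-> type_definable K S /\ invariant_over b S.
Proof.
move=> smallW smallV; split=> [dS|[[W' [d [Phi [smallW' SP]]]] inv]].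
  split; last exact: definable_over_invariant dS.
  by have [Phi SP] := dS; exists W, b, Phi.
have idS : @pull _ M _ _ (@rename_id _ V) @` S = S.
  apply/seteqP; split=> a; first by move=> [x Sx <-]; rewrite pull_id.
  by move=> Sa; exists a => //; rewrite pull_id.
rewrite -idS; apply: (@definable_over_image _ _ _ d) => //; rewrite ?idS//.
by exists Phi.
Qed.

Section FixedParameters.
Variables (W : ctx L) (b : tuple_of M W).
Hypothesis smallW : small K (var W).

Lemma definable_over_proj (V V' : ctx L) (f : rename V V')
    (R : set (tuple_of M V')) : small K (var V) -> small K (var V') ->
  definable_over b R -> definable_over b (@pull _ M _ _ f @` R).
Proof.
move=> smallV smallV' dR.
apply: (@definable_over_image _ _ b b) => //.
have Rinv := definable_over_invariant dR.
have key g a : aut_tuple g b = b -> (@pull _ M _ _ f @` R) a ->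
    (@pull _ M _ _ f @` R) (aut_tuple g a).
  move=> gb [x Rx <-]; exists (aut_tuple g x); last exact: aut_pull.
  exact/(Rinv g gb).
move=> g gb a; split=> [[x Rx xa]|]; last exact: key.
(* Only a tuple of preimages is needed, so [g] is inverted sort by sort without forming an inverse
   automorphism. *)
have hP s : exists h, cancel (g s) h /\ cancel h (g s).
  by have [h] := aut_bij g s; exists h.
pose h s : M s -> M s := sval (cid (hP s)).
have hK s : cancel (g s) (h s) by rewrite /h; case: cid => ? [].
have gK s : cancel (h s) (g s) by rewrite /h; case: cid => ? [].
have gy : aut_tuple g (fun v => h _ (x v)) = x.
  by apply: functional_extensionality_dep => v; exact: gK.
exists (fun v => h _ (x v)); first by apply/(Rinv g gb); rewrite gy.
apply: functional_extensionality_dep => v.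
move: xa; rewrite -[x in pull f x]gy aut_pull => xa.
rewrite -[LHS](hK (vsort v)) -[RHS](hK (vsort v)); congr (h _ _).
exact: (congr1 (fun c : tuple_of M V => c v) xa).
Qed.

Lemma definable_over_relpre (V V' : ctx L)
    (R : tuple_of M V -> tuple_of M V' -> Prop) (S : set (tuple_of M V')) :
  small K (var V) -> small K (var V') ->
  definable_over b (pair_set R) -> definable_over b S ->
  definable_over b [set x | exists2 y, S y & R x y].
Proof.
move=> smallV smallV' dR dS.
rewrite (_ : [set x | _] = @pull _ M _ _ (@rename_l _ V V') @`
    (pair_set R `&` [set z | S (pull (@rename_r _ V V') z)])).
  apply: definable_over_proj => //; first exact: small_cat.
  by apply: definable_overI => //; exact: definable_over_pull.
apply/seteqP; split=> x /=.
  move=> [y Sy Rxy]; exists (tuple_cat x y); last by rewrite pull_l.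
  by rewrite pull_r.
by move=> [z [Rz Sz] <-]; exists (pull (@rename_r _ V V') z).
Qed.

Lemma definable_over_relimg (V V' : ctx L)
    (R : tuple_of M V -> tuple_of M V' -> Prop) (S : set (tuple_of M V)) :
  small K (var V) -> small K (var V') ->
  definable_over b (pair_set R) -> definable_over b S ->
  definable_over b [set y | exists2 x, S x & R x y].
Proof.
move=> smallV smallV' dR dS; apply: definable_over_relpre => //.
exact: (definable_over_pull
  (rename_case (@rename_r _ V' V) (@rename_l _ V' V)) dR).
Qed.

(** If no formula separates, every formula valid on [S] is realised in [T]. Such formulas are closed
    under conjunction, so some point of [T] satisfies them all and therefore lies in [S]. *)
Lemma definable_over_separation (V : ctx L) (S T : set (tuple_of M V)) :
  small K (var V) -> definable_over b S -> definable_over b T ->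
  (forall a, S a -> ~ T a) ->
  exists D : set (tuple_of M V), [/\ definable_over b D,
    definable_over b (~` D), S `<=` D & T `<=` ~` D].
Proof.
move=> smallV dS dT disj; apply: contrapT => nsep.
have sepF (p : formula (ctx_cat V W)) :
    (forall a, S a -> holds_at p (tuple_cat a b)) ->
    [set a | T a /\ holds_at p (tuple_cat a b)] !=set0.
  move=> Sp; apply: contrapT => ne; apply: nsep.
  exists [set a | holds_at p (tuple_cat a b)]; split.
  - exact: definable_over_formula.
  - exact: (definable_over_formula b (Fnot p)).
  - by [].
  - by move=> a Ta pa; apply: ne; exists a.
pose Fp p : set (tuple_of M V) :=
  [set a | T a /\ holds_at p (tuple_cat a b)].
pose FF := [set Fp p | p in
  [set p | forall a, S a -> holds_at p (tuple_cat a b)]].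
have [|_ [p _ <-]|_ [p pS <-]|_ _ [p pS <-] [q qS <-]|a aFF] :=
  @directed_intersection _ b V FF smallW smallV.
- by exists (Fp (Ftrue _)); exists (Ftrue _) => //= ? ?.
- apply: definable_overI => //; exact: definable_over_formula.
- exact: sepF.
- exists (Fp (Fand p q)).
    by exists (Fand p q) => //= a Sa; apply/holds_and; split; auto.
  by move=> x [Rx /holds_and[px qx]]; split; split.
have Ta : T a.
  by apply: (aFF (Fp (Ftrue _)) _).1; exists (Ftrue _) => //= ? ?.
apply: (disj a) => //; have [Phi SP] := dS; apply/SP => p Phip.
by apply: (aFF (Fp p) _).2; exists p => // c /SP; exact.
Qed.

End FixedParameters.
End DefinableOver.

(** * Piecewise hyperdefinable sets and logic topologies *)

Section Classes.
Variables (L : language) (M : structure L) (K : Type).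
Variable Q : hyperdefinable M K.
Implicit Types c d : hquot Q.

Lemma class_inhabited c : exists x, sval c x.
Proof. by case: c => C /= [x Xx ->]; exists x; exact: hE_refl. Qed.

Lemma class_hX c x : sval c x -> @hX _ _ _ Q x.
Proof. by case: c => C /= [y Xy ->] /hE_sub[]. Qed.

Lemma class_eq c d x : sval c x -> sval d x -> c = d.
Proof.
case: c d => [C [y Xy Cy]] [D [z Xz Dz]] /= Cx Dx; apply: eq_exist.
rewrite {}Cy {}Dz in Cx Dx *; apply/seteqP; split=> u.
  by move=> /(hE_trans (hE_sym Cx)) /(hE_trans Dx).
by move=> /(hE_trans (hE_sym Dx)) /(hE_trans Cx).
Qed.

Lemma class_hE c x : sval c x -> sval c = hE (h := Q) x.
Proof.
case: c => C /= [y Xy ->] yx; apply/seteqP; split=> u.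
  exact: hE_trans (hE_sym yx).
exact: hE_trans.
Qed.

Lemma class_of x : @hX _ _ _ Q x -> exists c, sval c x.
Proof.
move=> Xx; exists (exist _ (hE (h := Q) x) (ex_intro2 _ _ x Xx erefl)).
exact: hE_refl.
Qed.

Lemma preim1_sval (D : set (hquot Q)) c x : sval c x -> preim1 D x <-> D c.
Proof.
move=> cx; split=> [[d Dd dx]|Dc]; last by exists c.
by rewrite (class_eq cx dx).
Qed.

Lemma preim1_hX (D : set (hquot Q)) x : preim1 D x -> @hX _ _ _ Q x.
Proof. by move=> [c _]; exact: class_hX. Qed.

End Classes.

Section DirectLimit.
Variables (L : language) (M : structure L) (K : Type).
Variable P : piecewise M K.

Lemma transition_irr (i j : pindex P) (h h' : piece_le i j) x :
  transition h x = transition h' x.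
Proof. by rewrite (Prop_irrelevance h h'). Qed.

Lemma germ_eq_sym (u v : {i : pindex P & hquot (piece i)}) :
  germ_eq u v -> germ_eq v u.
Proof. by move=> [k [hu [hv e]]]; exists k, hv, hu. Qed.

Lemma germ_eq_trans (u v w : {i : pindex P & hquot (piece i)}) :
  germ_eq u v -> germ_eq v w -> germ_eq u w.
Proof.
move=> [k [hu [hv e]]] [l [hv' [hw e']]].
have [m [km lm]] := pindex_directed k l.
exists m, (pindex_trans hu km), (pindex_trans hw lm).
rewrite -(transition_comp hu km) -(transition_comp hw lm) e -e'.
rewrite (transition_comp hv km (pindex_trans hv km)).
by rewrite (transition_comp hv' lm (pindex_trans hv km)).
Qed.

Lemma dlim_inP (i j : pindex P) (x : hquot (piece i)) (y : hquot (piece j)) :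
  dlim_in x = dlim_in y <-> germ_eq (existT _ i x) (existT _ j y).
Proof.
split=> [/(congr1 sval) /= ->|e]; last first.
  apply: eq_exist; apply/seteqP; split=> w; last exact: germ_eq_trans.
  exact: germ_eq_trans (germ_eq_sym e).
by exists j, (pindex_refl j), (pindex_refl j).
Qed.

Lemma dlim_in_inj (i : pindex P) : injective (@dlim_in _ _ _ P i).
Proof.
move=> x y /dlim_inP[k [/= hu [hv]]]; rewrite (transition_irr hv hu).
exact: transition_inj.
Qed.

Lemma dlim_in_transition (i j : pindex P) (h : piece_le i j) x :
  dlim_in (transition h x) = dlim_in x.
Proof.
apply/dlim_inP; exists j, (pindex_refl j), h.
by rewrite /= transition_id.
Qed.

Lemma dlim_ex (y : dlim P) :
  exists (i : pindex P) (c : hquot (piece i)), y = dlim_in c.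
Proof.
by case: y => C p; have [[i c] _ e] := p; exists i, c; exact: eq_exist.
Qed.

Lemma range_dlim_in_le (i j : pindex P) : piece_le i j ->
  range (@dlim_in _ _ _ P i) `<=` range (@dlim_in _ _ _ P j).
Proof.
by move=> h _ [x _ <-]; exists (transition h x) => //;
  rewrite dlim_in_transition.
Qed.

Definition preim_at (i : pindex P) (D : set (dlim P)) :=
  preim1 [set x : hquot (piece i) | D (dlim_in x)].
Arguments preim_at i D _ : clear implicits.

Lemma preim_at_sval i D (c : hquot (piece i)) x :
  sval c x -> preim_at i D x <-> D (dlim_in c).
Proof. exact: preim1_sval. Qed.

Lemma preim_at0 i : preim_at i set0 = set0.
Proof. by apply/seteqP; split=> x // [c]. Qed.

Lemma preim_atU i D D' : preim_at i (D `|` D') = preim_at i D `|` preim_at i D'.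
Proof.
apply/seteqP; split=> x; first by move=> [c [Dc|Dc] cx]; [left|right]; exists c.
by move=> [[c Dc cx]|[c Dc cx]]; exists c => //; [left|right].
Qed.

(** The factor [hX] accounts for the empty family, which would otherwise yield all tuples. *)
Lemma preim_at_bigcap i (I : Type) (D : I -> set (dlim P)) :
  preim_at i (\bigcap_k D k) =
  @hX _ _ _ (piece i) `&`
  [set x | forall S, [set preim_at i (D k) | k in setT] S -> S x].
Proof.
apply/seteqP; split=> x.
  move=> [c Dc cx]; split; first exact: class_hX cx.
  by move=> _ [k _ <-]; exists c => //; exact: Dc.
move=> [/class_of[c cx] H]; exists c => // k _.
by apply/(preim_at_sval _ cx); apply: H; exists k.
Qed.

Lemma preim_atI i D D' : preim_at i (D `&` D') = preim_at i D `&` preim_at i D'.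
Proof.
apply/seteqP; split=> x; first by move=> [c [Dc D'c] cx]; split; exists c.
move=> [[c Dc cx] /(preim_at_sval _ cx) D'c]; by exists c.
Qed.

Lemma preim_at_range i :
  preim_at i (range (@dlim_in _ _ _ P i)) = @hX _ _ _ (piece i).
Proof.
apply/seteqP; split=> x; first exact: preim1_hX.
by move=> /class_of[c cx]; exists c => //; exists c.
Qed.

Lemma preim_at_set1 i (c : hquot (piece i)) :
  preim_at i [set dlim_in c] = sval c.
Proof.
apply/seteqP; split=> x; first by move=> [d /dlim_in_inj ->].
by move=> cx; exists c.
Qed.

End DirectLimit.
Arguments preim_at {L M K P} i D _.

Section PiecewiseDefinable.
Variables (L : language) (M : structure L) (K : Type).
Hypothesis K_strong_limit : strong_limit K.
Hypothesis M_saturated : saturated M K.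
Hypothesis M_homogeneous : strongly_homogeneous M K.
Variables (W : ctx L) (b : tuple_of M W).
Hypothesis smallW : small K (var W).
Local Notation defb := (definable_over b).
Variable P : piecewise M K.
Hypothesis hX_over : forall i : pindex P, defb (@hX _ _ _ (piece i)).
Hypothesis hE_over : forall i : pindex P, defb (pair_set (@hE _ _ _ (piece i))).
Hypothesis transition_over : forall (i j : pindex P) (h : piece_le i j),
  defb (preim2 (fun c d => transition h c = d)).

Definition pw_definable_over (D : set (dlim P)) :=
  forall i : pindex P, defb (preim_at i D).

(** The set is pushed forward from piece [i] to a piece above both [i] and [j], then pulled back to
    piece [j], along definable graphs. *)
Lemma pw_definable_in_piece (i : pindex P) (D : set (dlim P)) :
  D `<=` range (@dlim_in _ _ _ P i) -> defb (preim_at i D) ->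
  pw_definable_over D.
Proof.
move=> Di dD j; have [k [ik jk]] := pindex_directed i j.
pose R i k (h : piece_le i k) x y := exists c d,
  [/\ transition (p := P) h c = d, sval c x & sval d y].
rewrite (_ : preim_at j D =
  [set x | exists2 w, [set w | exists2 z, preim_at i D z & R _ _ ik z w] w &
     R _ _ jk x w]).
  apply: (definable_over_relpre K_strong_limit M_saturated M_homogeneous) => //;
    try exact: hvar_small.
  - exact: transition_over.
  - apply: (definable_over_relimg K_strong_limit M_saturated M_homogeneous)
      => //;
      try exact: hvar_small.
    exact: transition_over.
apply/seteqP; split=> x.
  move=> [c Dc cx]; have [c' _ c'c] := Di _ Dc.
  have ee : transition ik c' = transition jk c.
    by apply: dlim_in_inj; rewrite !dlim_in_transition.
  have [w dw] := class_inhabited (transition jk c).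
  have [z c'z] := class_inhabited c'.
  exists w; last by exists c, (transition jk c).
  exists z; first by apply/(preim_at_sval _ c'z); rewrite c'c.
  by exists c', (transition jk c).
move=> [w [z [c' Dc' c'z] [c'' [d [e c''z dw]]]] [c [d' [e' cx d'w]]]].
exists c => //=; rewrite -(dlim_in_transition jk) e' (class_eq d'w dw) -e.
by rewrite dlim_in_transition (class_eq c''z c'z).
Qed.

Lemma pw_definable_piece (i : pindex P) :
  pw_definable_over (range (@dlim_in _ _ _ P i)).
Proof. by apply: (@pw_definable_in_piece i) => //; rewrite preim_at_range. Qed.

Lemma pw_definableI D D' :
  pw_definable_over D -> pw_definable_over D' -> pw_definable_over (D `&` D').
Proof. by move=> dD dD' i; rewrite preim_atI; exact: definable_overI. Qed.

Lemma piece_compact (i : pindex P) (FF : set (set (dlim P))) :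
  FF !=set0 -> (forall D, FF D -> pw_definable_over D) ->
  (forall D, FF D -> exists c : hquot (piece i), D (dlim_in c)) ->
  (forall D D', FF D -> FF D' -> exists2 E, FF E & E `<=` D `&` D') ->
  exists c : hquot (piece i), forall D, FF D -> D (dlim_in c).
Proof.
move=> [D0 FFD0] FFdef FFne FFdir.
have [|_ [D FFD <-]|_ [D FFD <-]|_ _ [D FFD <-] [D' FFD' <-]|x xFF] :=
  @directed_intersection _ M K K_strong_limit M_saturated W b _
    [set preim_at i D | D in FF] smallW (hvar_small (piece i)).
- by exists (preim_at i D0); exists D0.
- exact: FFdef.
- have [c Dc] := FFne D FFD; have [x cx] := class_inhabited c.
  by exists x; exists c.
- have [E FFE ED] := FFdir D D' FFD FFD'.
  exists (preim_at i E); first by exists E.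
  by move=> x [c /ED[Dc D'c] cx]; split; exists c.
have [c _ cx] : preim_at i D0 x by apply: xFF; exists D0.
by exists c => D FFD; apply/(preim_at_sval _ cx); apply: xFF; exists D.
Qed.

Lemma piece_separation (i : pindex P) (c d : hquot (piece i)) :
  defb (sval c) -> defb (sval d) -> c <> d ->
  exists D D' : set (dlim P),
    [/\ pw_definable_over D, pw_definable_over D',
        range (@dlim_in _ _ _ P i) `<=` D `|` D',
        ~ D (dlim_in c) & ~ D' (dlim_in d)].
Proof.
move=> dc dd cd.
have [|S [dS dS' cS dSS]] := definable_over_separation K_strong_limit
  M_saturated smallW (hvar_small (piece i)) dc dd.
  by move=> x cx dx; apply: cd; exact: class_eq cx dx.
(* [S] need not be a union of classes, so [sat T] takes the classes meeting [T]; a class meeting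
   both [S] and its complement lies in both closed sets. *)
pose sat (T : set (tuple_of M (hvar (piece i)))) :=
  [set y | exists2 e : hquot (piece i), y = dlim_in e &
    exists2 x, T x & sval e x].
have satP T e : sat T (dlim_in e) <-> exists2 x, T x & sval e x.
  by split=> [[e' /dlim_in_inj ->//]|H]; exists e.
have sat_def T : defb T -> pw_definable_over (sat T).
  move=> dT; apply: (@pw_definable_in_piece i).
    by move=> _ [e -> _]; exists e.
  rewrite (_ : preim_at i _ = [set x | exists2 y, T y & hE (h := piece i) x y]).
    apply: (definable_over_relpre K_strong_limit M_saturated M_homogeneous)
      => //;
      exact: hvar_small.
  apply/seteqP; split=> x.
    move=> [e /= /satP[y Ty ey] ex]; exists y => //.
    by rewrite -(class_hE ex).
  move=> [y Ty xy]; have [e ex] := class_of (hE_sub xy).1.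
  by exists e => //=; apply/satP; exists y => //; rewrite (class_hE ex).
exists (sat (~` S)), (sat S); split; [exact: sat_def|exact: sat_def| | |].
- move=> _ [e _ <-]; have [x ex] := class_inhabited e.
  by have [Sx|nSx] := pselect (S x); [right|left]; apply/satP; exists x.
- by move=> /satP[x nSx /cS].
- by move=> /satP[x Sx /dSS].
Qed.

End PiecewiseDefinable.

(** * Topological properties drawn from definability over one tuple *)

Section LogicTopology.
Variables (L : language) (M : structure L) (K : Type).
Hypothesis K_strong_limit : strong_limit K.
Hypothesis M_saturated : saturated M K.
Hypothesis M_homogeneous : strongly_homogeneous M K.
Variable P : piecewise M K.

Section Topology.
Variables (W : ctx L) (b : tuple_of M W).
Hypothesis smallW : small K (var W).
Local Notation defb := (definable_over b).
Hypothesis hX_over : forall i : pindex P, defb (@hX _ _ _ (piece i)).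
Hypothesis hE_over : forall i : pindex P, defb (pair_set (@hE _ _ _ (piece i))).
Hypothesis transition_over : forall (i j : pindex P) (h : piece_le i j),
  defb (preim2 (fun c d => transition h c = d)).
Hypothesis class_over : forall (i : pindex P) (c : hquot (piece i)),
  defb (sval c).
Local Notation pw_def := (pw_definable_over b).
Variable tau : set (set (dlim P)).
Hypothesis tauP : is_topology tau.
Hypothesis tauE : forall D : set (dlim P), tau (~` D) <-> pw_def D.
Hypothesis local : forall x : dlim P, exists N U : set (dlim P),
  [/\ pw_def N, in_piece N, tau U, U x & U `<=` N].
Local Notation X := (tau_space tauP).

Lemma tau_closedE (D : set X) : closed D <-> pw_def D.
Proof. by rewrite -openC -tauE. Qed.

Lemma tau_openE (U : set X) : open U <-> pw_def (~` U).
Proof. by rewrite -closedC tau_closedE. Qed.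

Lemma tau_hausdorff : hausdorff_space X.
Proof.
rewrite open_hausdorff => x y /eqP xy.
have [N [U [defN [i Ni] tauU Ux UN]]] := local x.
have oU : @open X U by rewrite tau_space_openE.
(* A point outside the closed set [N] is separated by its complement; otherwise both points lie in
   piece [i]. *)
have [Ny|nNy] := pselect (N y); last first.
  exists (U, ~` N); first by rewrite !inE.
  split=> //=; first by apply/tau_openE; rewrite setCK.
  by apply/eqP/seteqP; split=> // z [/UN].
have [N' [U' [defN' _ tauU' U'y U'N']]] := local y.
have oU' : @open X U' by rewrite tau_space_openE.
have [c _ cx] := Ni _ (UN _ Ux); have [d _ dy] := Ni _ Ny.
have [|D [D' [defD defD' cov nDc nD'd]]] := piece_separation K_strong_limit
  M_saturated M_homogeneous smallW hE_over transition_over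
  (class_over c) (class_over d).
  by move=> cd; apply: xy; rewrite -cx -dy cd.
have oC E : pw_def E -> @open X (~` E).
  by move=> ?; apply/tau_openE; rewrite setCK.
(* [D] and [D'] are only known to cover piece [i]; the factor [U] keeps the intersection inside that
   piece. *)
exists (U `&` ~` D, U' `&` ~` D').
  by rewrite !inE; split; split=> //=; rewrite -?cx -?dy.
split=> /=; [by apply: openI => //; exact: oC
            |by apply: openI => //; exact: oC|].
apply/eqP/seteqP; split=> // z [[/UN/Ni zi nD] [_ nD']].
by have [] := cov z zi.
Qed.

(** Closed members of the filter inside [N] form a directed family on one piece. A common point is a
    cluster point, since the closure of any member of the filter, cut down to [N], belongs to the
    family. *)
Lemma tau_compact (N : set X) : pw_def N -> in_piece N -> compact N.
Proof.
move=> defN [i Ni] F FF FN.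
pose FD := [set D : set (dlim P) | [/\ pw_def D, F D & D `<=` N]].
have [||D [_ FD' DN]|D D' [dD FD1 DN] [dD' FD2 _]|c cFD] :=
  @piece_compact _ M K K_strong_limit M_saturated _ b smallW P i FD.
- by exists N; split.
- by move=> D [].
- have [x Dx] := filter_ex FD'; have [c _ cx] := Ni _ (DN _ Dx).
  by exists c; rewrite cx.
- exists (D `&` D') => //; split; [exact: pw_definableI|exact: filterI|].
  by move=> x [/DN].
exists (dlim_in c); split; first by apply: (cFD N); split.
rewrite clusterE => A FA.
have [] // : (closure A `&` N) (dlim_in c).
apply: cFD; split; last by move=> x [].
- apply: pw_definableI => //; apply/tau_closedE; exact: closed_closure.
- by apply: filterI => //; apply: filterS FA; exact: subset_closure.
Qed.

Lemma tau_locally_compact : locally_compact [set: X].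
Proof.
move=> x _; have [N [U [defN Ni tauU Ux UN]]] := local x.
have nN : @nbhs _ X x N by apply: filterS UN _; exact: open_nbhs_nbhs.
exists N; first by rewrite withinET.
by split; [exact: tau_compact|exact/tau_closedE].
Qed.

(* The sets of pairs (u, v) in F * H with [op u v \in C], for F and H closed
   neighbourhoods of x and y, form a directed family of definable sets; were
   all of them nonempty, saturation would give a common element, which can only
   be (x, y). *)
Lemma definable_op_continuous (op : dlim P -> dlim P -> dlim P) :
  (forall i j : pindex P, exists k : pindex P,
    forall (x : hquot (piece i)) (y : hquot (piece j)),
    range (@dlim_in _ _ _ P k) (op (dlim_in x) (dlim_in y))) ->
  (forall i j k : pindex P, defb (preim3
    (fun (x : hquot (piece i)) (y : hquot (piece j)) (z : hquot (piece k)) =>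
      op (dlim_in x) (dlim_in y) = dlim_in z))) ->
  continuous (fun z : X * X => op z.1 z.2 : X).
Proof.
move=> op_bounded op_over [x y] V /=; rewrite nbhsE => -[V' [oV' V'xy] V'V].
pose C : set (dlim P) := ~` V'.
have defC : pw_def C by exact/tau_openE.
pose cnbhs (z : dlim P) (D : set (dlim P)) :=
  pw_def D /\ exists U : set (dlim P), [/\ tau U, U z & U `<=` D].
have cnbhsI z D D' : cnbhs z D -> cnbhs z D' -> cnbhs z (D `&` D').
  move=> [dD [U [tU Uz UD]]] [dD' [U' [tU' U'z U'D']]].
  split; first exact: pw_definableI.
  exists (U `&` U'); split=> //; first by have [_ tI _] := tauP; exact: tI.
  by move=> w [/UD ? /U'D'].
(* For [w] other than [z], the complement of a suitable open neighbourhood of [w] is a closed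
   neighbourhood of [z]. *)
have cnbhs_eq z w : (forall D, cnbhs z D -> D w) -> w = z.
  move=> zw; apply: contrapT => nwz; have := tau_hausdorff.
  rewrite open_hausdorff => /(_ z w) [|[U1 U2] /= [zU1 wU2] [oU1 oU2 /eqP U12]].
    by apply/eqP => zw'; exact: nwz.
  rewrite !inE in zU1 wU2.
  suff : (~` U2) w by [].
  apply: zw; split; first exact/tau_openE.
  exists U1; split; [by []|by []|] => u U1u U2u.
  by have : set0 u by rewrite -U12.
have cnbhs_nbhs z D : cnbhs z D -> @nbhs _ X z D.
  by move=> [_ [U [tU Uz UD]]]; apply: filterS UD _; exact: open_nbhs_nbhs.
have [N [U [defN [i Ni] tU Ux UN]]] := local x.
have [N' [U' [defN' [j N'j] tU' U'y U'N']]] := local y.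
have cN : cnbhs x N by split=> //; exists U.
have cN' : cnbhs y N' by split=> //; exists U'.
have [k kP] := op_bounded i j.
pose Q : set (tuple_of M (ctx_cat (hvar (piece i)) (hvar (piece j)))) :=
  [set z | exists2 w, preim_at k C w & preim2
    (fun (c : hquot (piece i)) (d : hquot (piece j)) =>
      exists2 e : hquot (piece k), op (dlim_in c) (dlim_in d) = dlim_in e &
      sval e w) z].
pose l := @rename_l _ (hvar (piece i)) (hvar (piece j)).
pose r := @rename_r _ (hvar (piece i)) (hvar (piece j)).
pose T D D' := Q `&` ([set z | preim_at i D (pull l z)] `&`
  [set z | preim_at j D' (pull r z)]).
have smalli := hvar_small (piece i); have smallj := hvar_small (piece j).
have smallij := small_cat K_strong_limit smalli smallj.
have defQ : defb Q.
  rewrite (_ : Q = [set z | exists2 w, preim_at k C w &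
    exists e : hquot (piece k), preim2
      (fun (c : hquot (piece i)) (d : hquot (piece j)) =>
      op (dlim_in c) (dlim_in d) = dlim_in e) z /\ sval e w]).
    apply: (definable_over_relpre K_strong_limit M_saturated M_homogeneous
      smallW smallij (hvar_small (piece k)) (op_over i j k)); exact: defC.
  apply/seteqP; split=> z.
    move=> [w Cw [c [d [[e ee ew] cz dz]]]].
    by exists w => //; exists e; split=> //; exists c, d.
  move=> [w Cw [e [[c [d [ee cz dz]]] ew]]].
  by exists w => //; exists c, d; split=> //; exists e.
(* If a box misses [Q], cutting it down to [N] and [N'] brings its points into pieces [i] and [j],
   where [Q] detects every value in [C]. *)
have [[D [D' [cD cD' TDD']]]|ne] := pselect (exists D D',
    [/\ cnbhs x D, cnbhs y D' & T D D' = set0]).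
  exists (D `&` N, D' `&` N').
    by split=> /=; apply: cnbhs_nbhs; exact: cnbhsI.
  move=> [u v] /= [[Du Nu] [D'v N'v]]; apply: V'V; apply: contrapT => Cuv.
  have [c _ cu] := Ni _ Nu; have [d _ dv] := N'j _ N'v.
  have [e _ ee] := kP c d.
  have [z1 cz] := class_inhabited c; have [z2 dz] := class_inhabited d.
  have [w ew] := class_inhabited e.
  suff : set0 (tuple_cat z1 z2) by [].
  rewrite -TDD'; split.
    exists w; first by apply/(preim_at_sval _ ew); rewrite ee cu dv.
    by exists c, d; split=> //; exists e.
  split; rewrite /= ?pull_l ?pull_r.
    by apply/(preim_at_sval _ cz); rewrite cu.
  by apply/(preim_at_sval _ dz); rewrite dv.
exfalso.
pose FF := [set S | exists D D', [/\ cnbhs x D, cnbhs y D' & S = T D D']].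
have [|_ [D [D' [cD cD' ->]]]|_ [D [D' [cD cD' ->]]]
     |_ _ [D [D' [cD cD' ->]]] [E [E' [cE cE' ->]]]|z zFF] :=
  @directed_intersection _ M K K_strong_limit M_saturated W b _ FF
    smallW smallij.
- by exists (T N N'); exists N, N'.
- apply: definable_overI => //; apply: definable_overI.
    by apply: (definable_over_pull l); exact: cD.1.
  by apply: (definable_over_pull r); exact: cD'.1.
- apply: contrapT => e; apply: ne; exists D, D'; split=> //.
  by apply/seteqP; split=> // w Tw; apply: e; exists w.
- exists (T (D `&` E) (D' `&` E')).
    by exists (D `&` E), (D' `&` E'); split=> //; exact: cnbhsI.
  move=> w [Qw]; rewrite !preim_atI => -[[Dw Ew] [D'w E'w]].
  by split; split.
have TNN' : T N N' z by apply: zFF; exists N, N'.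
have [[w Cw [c [d [[e ee ew] cz dz]]]] _] := TNN'.
(* With the other factor kept fixed, one factor runs over all closed neighbourhoods, which
   determines that coordinate. *)
have cx : dlim_in c = x.
  apply: cnbhs_eq => D cD.
  have [|_ [Dz _]] := zFF (T D N'); first by exists D, N'.
  exact/(preim_at_sval _ cz).
have dy : dlim_in d = y.
  apply: cnbhs_eq => D cD.
  have [|_ [_ Dz]] := zFF (T N D); first by exists N, D.
  exact/(preim_at_sval _ dz).
have nV : ~ V' (dlim_in e) by apply/(preim_at_sval C ew).
by apply: nV; rewrite -ee cx dy.
Qed.

(** On each piece, the preimage of a closed set is its inverse image under a definable graph, taken
    in one piece that bounds the values. *)
Lemma definable_map_continuous (f : dlim P -> dlim P) :
  (forall i : pindex P, exists j : pindex P, forall x : hquot (piece i),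
    range (@dlim_in _ _ _ P j) (f (dlim_in x))) ->
  (forall i j : pindex P, defb (preim2
    (fun (x : hquot (piece i)) (y : hquot (piece j)) =>
      f (dlim_in x) = dlim_in y))) ->
  continuous (fun x : X => f x : X).
Proof.
move=> f_bounded f_over; apply/continuousP => V /tau_openE dV.
apply/tau_openE => i; have [j jP] := f_bounded i.
rewrite (_ : preim_at i _ = [set x | exists2 y, preim_at j (~` V) y &
  (exists (c : hquot (piece i)) (d : hquot (piece j)),
    [/\ f (dlim_in c) = dlim_in d, sval c x & sval d y])]).
  apply: (definable_over_relpre K_strong_limit M_saturated M_homogeneous
    smallW (hvar_small _) (hvar_small _) (f_over i j)); exact: dV.
apply/seteqP; split=> x.
  move=> [c nVc cx]; have [d _ dc] := jP c.
  have [y dy] := class_inhabited d; exists y; last by exists c, d.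
  by apply/(preim_at_sval _ dy); rewrite dc.
move=> [y nVy [c [d [fcd cx dy]]]]; exists c => //= fV.
have nV := (preim_at_sval _ dy).1 nVy.
by apply: nV; rewrite -fcd.
Qed.

End Topology.
End LogicTopology.

(** * From hyperimaginary parameters to a real tuple *)

Section LogicOpen.
Variables (L : language) (M : structure L) (K : Type).
Hypothesis K_strong_limit : strong_limit K.
Hypothesis M_saturated : saturated M K.
Hypothesis M_homogeneous : strongly_homogeneous M K.
Variable P : piecewise M K.
Variables (W : ctx L) (b : tuple_of M W).
Hypothesis smallW : small K (var W).
Local Notation defb := (definable_over b).
Variable A : param_set M K.
Hypothesis fixA : forall g : automorphism M, aut_tuple g b = b -> fixes g A.
Hypothesis overA : piecewise_over A P.

Lemma bigwedge_definable_over (V : ctx L) (S : set (tuple_of M V)) :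
  small K (var V) -> bigwedge A S -> defb S.
Proof.
move=> smallV [dS invS].
apply/(definable_overP K_strong_limit M_saturated M_homogeneous b
  S smallW smallV).
by split=> // g /fixA; exact: invS.
Qed.

(** Invariance over [A] is a separate condition, since automorphisms fixing [A] may move [b]. *)
Lemma definable_over_bigwedge (V : ctx L) (S : set (tuple_of M V)) :
  small K (var V) -> defb S -> param_invariant A S -> bigwedge A S.
Proof.
move=> smallV dS invS; split=> //.
by apply (definable_overP K_strong_limit M_saturated M_homogeneous b
  S smallW smallV).
Qed.

Lemma piece_hX_over (i : pindex P) : defb (@hX _ _ _ (piece i)).
Proof.
apply: bigwedge_definable_over; first exact: hvar_small.
by split; [exact: hX_def|exact: (overA.1 i).1].
Qed.

Lemma piece_hE_over (i : pindex P) : defb (pair_set (@hE _ _ _ (piece i))).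
Proof.
apply: bigwedge_definable_over.
  by apply: small_cat => //; exact: hvar_small.
by split; [exact: hE_def|exact: (overA.1 i).2].
Qed.

Lemma piece_transition_over (i j : pindex P) (h : piece_le i j) :
  defb (preim2 (fun c d => transition h c = d)).
Proof.
apply: bigwedge_definable_over; last exact: overA.2.
by apply: small_cat => //; exact: hvar_small.
Qed.

Lemma logic_open_topology : is_topology (@logic_open _ _ _ P A).
Proof.
split.
- rewrite /logic_open /= setCT => i; change (bigwedge A (preim_at i set0)).
  rewrite preim_at0; apply: definable_over_bigwedge (hvar_small _) _ _.
    exact: definable_over0.
  by move=> g _ a.
- move=> U V oU oV; rewrite /logic_open /= setCI => i.
  change (bigwedge A (preim_at i (~` U `|` ~` V))); rewrite preim_atU.
  have dU := oU i; have dV := oV i.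
  apply: definable_over_bigwedge (hvar_small _) _ _.
    by apply: definable_overU; apply: bigwedge_definable_over (hvar_small _) _.
  move=> g gA a; have eU := dU.2 g gA a; have eV := dV.2 g gA a.
  by split=> -[H|H]; [left|right|left|right]; first [exact/eU|exact/eV].
- move=> I f of_; rewrite /logic_open /= setC_bigcup => i.
  change (bigwedge A (preim_at i (\bigcap_k ~` f k))); rewrite preim_at_bigcap.
  apply: definable_over_bigwedge (hvar_small _) _ _.
    apply: definable_overI; first exact: piece_hX_over.
    apply: definable_over_forall => _ [k _ <-].
    exact: bigwedge_definable_over (hvar_small _) (of_ k i).
  move=> g gA a; split=> -[Xa H]; split.
  + exact/((overA.1 i).1 g gA).
  + by move=> _ [k _ <-]; apply/((of_ k i).2 g gA a); apply: H; exists k.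
  + exact/((overA.1 i).1 g gA).
  + by move=> _ [k _ <-]; apply/((of_ k i).2 g gA a); apply: H; exists k.
Qed.

Hypothesis T1A : T1_topology (@logic_open _ _ _ P A).

(** In a T1 topology the complement of a point is a union of open sets. *)
Lemma T1_bigwedge_class (i : pindex P) (c : hquot (piece i)) :
  bigwedge A (sval c).
Proof.
suff /(_ i) : pw_bigwedge A [set dlim_in c].
  rewrite -[X in bigwedge A X -> _]/(preim_at i [set dlim_in c]).
  by rewrite preim_at_set1.
suff : logic_open A (~` [set dlim_in c]) by rewrite /logic_open /= setCK.
pose I := {U | logic_open A U /\ ~ U (dlim_in c)}.
rewrite (_ : ~` _ = \bigcup_(u in [set: I]) sval u).
  by have [_ _] := logic_open_topology; apply=> -[U []].
apply/seteqP; split=> x /=.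
  by move=> /T1A[U [oU Ux nUc]]; exists (exist _ U (conj oU nUc)).
by move=> [[U /= [_ nUc]] _ Ux] xc; apply: nUc; rewrite -xc.
Qed.

Lemma T1_class_over (i : pindex P) (c : hquot (piece i)) : defb (sval c).
Proof. exact: bigwedge_definable_over (hvar_small _) (T1_bigwedge_class c). Qed.

Lemma T1_class_invariant (i : pindex P) (c : hquot (piece i)) g x :
  fixes g A -> sval c (aut_tuple g x) <-> sval c x.
Proof. by move=> gA; exact: (T1_bigwedge_class c).2. Qed.

Lemma T1_pw_bigwedgeE (D : set (dlim P)) :
  pw_bigwedge A D <-> pw_definable_over b D.
Proof.
split=> dD i; first exact: bigwedge_definable_over (hvar_small _) (dD i).
apply: definable_over_bigwedge (hvar_small _) (dD i) _ => g gA a.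
by split=> -[c Dc ca]; exists c => //; apply/(T1_class_invariant c a gA).
Qed.

(** As each class is invariant over [A], so is every set of classes; type-definability over any
    small parameters is then enough. *)
Lemma T1_pw_definable (D : set (dlim P)) :
  (forall i, type_definable K (preim_at i D)) -> pw_definable_over b D.
Proof.
move=> tD; apply/T1_pw_bigwedgeE => i; split=> // g gA a.
by split=> -[c Dc ca]; exists c => //; apply/(T1_class_invariant c a gA).
Qed.

Lemma T1_preim2_over (i j : pindex P)
    (D : hquot (piece i) -> hquot (piece j) -> Prop) :
  type_definable K (preim2 D) -> defb (preim2 D).
Proof.
move=> tD; have smallij := small_cat K_strong_limit
  (hvar_small (piece i)) (hvar_small (piece j)).
apply/(definable_overP K_strong_limit M_saturated M_homogeneous b
  _ smallW smallij).
split=> // g /fixA gA a.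
by split=> -[c [d [Dcd ca da]]]; exists c, d; split=> //;
  first [exact/(T1_class_invariant c _ gA)|exact/(T1_class_invariant d _ gA)].
Qed.

Lemma T1_preim3_over (i j k : pindex P)
    (D : hquot (piece i) -> hquot (piece j) -> hquot (piece k) -> Prop) :
  type_definable K (preim3 D) -> defb (preim3 D).
Proof.
move=> tD; have smallijk := small_cat K_strong_limit
  (small_cat K_strong_limit (hvar_small (piece i)) (hvar_small (piece j)))
  (hvar_small (piece k)).
apply/(definable_overP K_strong_limit M_saturated M_homogeneous b
  _ smallW smallijk).
split=> // g /fixA gA a.
by split=> -[e [[c [d [Dcd ca da]]] ea]]; exists e; split;
  [exists c, d; split=> // | | exists c, d; split=> // | ];
  first [exact/(T1_class_invariant c _ gA)|exact/(T1_class_invariant d _ gA)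
        |exact/(T1_class_invariant e _ gA)].
Qed.

End LogicOpen.

(** * Locally compact groups *)

Section Baire.
Variable X : topologicalType.
Hypothesis X_hausdorff : hausdorff_space X.
Hypothesis X_locally_compact : locally_compact [set: X].

Lemma locally_compact_shrink (x : X) (O : set X) : open O -> O x ->
  exists U : set X, [/\ open U, U x, compact (closure U) & closure U `<=` O].
Proof.
move=> oO Ox; have [C] := X_locally_compact (x := x) I.
rewrite withinET => nC [cptC clC].
have [|V nV VO] := compact_regular X_hausdorff cptC nC (t := O `&` C).
  by apply: filterI => //; exact: open_nbhs_nbhs.
have UV : closure V° `<=` O `&` C.
  by apply: subset_trans VO; apply: closureS; exact: interior_subset.
exists V°; split=> //.
- exact: open_interior.
- apply: (subclosed_compact _ cptC); first exact: closed_closure.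
  by move=> y /UV[].
- by move=> y /UV[].
Qed.

(** If no [F n] had interior, nested open sets with compact closures could avoid each [F n] in turn,
    and a cluster point of them would lie in no [F n]. *)
Lemma locally_compact_baire (x0 : X) (F : nat -> set X) :
  (forall n, closed (F n)) -> (forall x, exists n, F n x) ->
  exists n (U : set X), [/\ open U, U !=set0 & U `<=` F n].
Proof.
move=> clF covF; apply: contrapT => nint.
(* [choice] needs a value for every pair; [set0] is a dummy when [U] is empty or not open. *)
have step (nU : nat * set X) : exists U' : set X, open nU.2 -> nU.2 !=set0 ->
    [/\ open U', U' !=set0, compact (closure U') &
        closure U' `<=` nU.2 `\` F nU.1].
  case: nU => n U /=; have [oU|] := pselect (open U); last by exists set0.
  have [U0|] := pselect (U !=set0); last by exists set0.
  have [x [Ux nFx]] : (U `\` F n) !=set0.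
    apply: contrapT => ne; apply: nint; exists n, U; split=> // x Ux.
    by apply: contrapT => nFx; apply: ne; exists x.
  have [||U' [oU' U'x cU' U'U]] := @locally_compact_shrink x (U `\` F n).
  - by apply: openI => //; rewrite openC.
  - by [].
  by exists U' => _ _; split=> //; exists x.
have [s sP] := choice step.
pose U := fix U n := if n is m.+1 then s (m, U m) else [set: X].
have UP n : open (U n) /\ U n !=set0.
  elim: n => [|n [oU U0]] /=; first by split; [exact: openT|exists x0].
  by have [] := sP (n, U n) oU U0.
have US n : closure (U n.+1) `<=` U n `\` F n.
  by have [oU U0] := UP n; have [] := sP (n, U n) oU U0.
have Ule m n : (m <= n)%N -> U n `<=` U m.
  move=> /subnK <-; elim: (n - m)%N => [|k IH] //.
  by move=> x /subset_closure /US [/IH].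
(* The shift starts at [U 1], the first set known to have compact closure, as [U 0] is the whole
   space. *)
pose FU := filter_from [set: nat] (fun n => U n.+1).
have FUf : Filter FU.
  apply: filter_from_filter; first by exists 0%N.
  move=> m n _ _; exists (maxn m n) => // x Ux; split; apply: Ule Ux.
    exact: leq_maxl.
  exact: leq_maxr.
have FUp : ProperFilter FU.
  by apply: filter_from_proper => n _; exact: (UP n.+1).2.
have [oU0 U0] := UP 0%N.
have [_ _ cU1 _] := sP (0%N, U 0%N) oU0 U0.
have [|x [_]] := cU1 FU FUp; first by exists 0%N => //; exact: subset_closure.
rewrite clusterE => clx; have [n Fnx] := covF x.
have : closure (U n.+1) x by apply: clx; exists n.
by move=> /US[].
Qed.

End Baire.

(** * Topology of piecewise hyperdefinable groups *)

Section Group.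
Variables (L : language) (M : structure L) (K : Type).
Hypothesis K_strong_limit : strong_limit K.
Hypothesis M_saturated : saturated M K.
Hypothesis M_homogeneous : strongly_homogeneous M K.
Variable G : pw_group M K.
Hypothesis G_group : piecewise_hyperdefinable_group G.

Lemma global_locally_compact_group tau : locally_hyperdefinable G ->
  global_logic_topology tau -> locally_compact_group (G := G) tau.
Proof.
move=> [A' [_ _ local]] [[A [[_ [W [b [smallW fixA]]]] overA ->]] T1A].
have tauP := logic_open_topology K_strong_limit M_saturated M_homogeneous
  smallW fixA overA.
have hX_over := piece_hX_over K_strong_limit M_saturated M_homogeneous
  smallW fixA overA.
have hE_over := piece_hE_over K_strong_limit M_saturated M_homogeneous
  smallW fixA overA.
have tr_over := piece_transition_over K_strong_limit M_saturated M_homogeneous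
  smallW fixA overA.
have cl_over := T1_class_over K_strong_limit M_saturated M_homogeneous
  smallW fixA overA T1A.
have tauE (D : set (dlim G)) : logic_open A (~` D) <-> pw_definable_over b D.
  rewrite /logic_open /= setCK.
  exact: (T1_pw_bigwedgeE K_strong_limit M_saturated M_homogeneous
    smallW fixA overA T1A).
(* Local hyperdefinability comes with its own parameters [A']; by T1 its closed sets are also closed
   over [A]. *)
have pw_def (D : set (dlim G)) : pw_bigwedge A' D -> pw_definable_over b D.
  move=> dD; apply: (T1_pw_definable K_strong_limit M_saturated M_homogeneous
    smallW fixA overA T1A) => i; exact: (dD i).1.
have localb (x : dlim G) : exists N U : set (dlim G),
    [/\ pw_definable_over b N, in_piece N, logic_open A U, U x & U `<=` N].
  have [N [U [dN Ni oU Ux UN]]] := local x.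
  exists N, U; split=> //; first exact: pw_def.
  by rewrite -[U]setCK; apply/tauE; exact: pw_def.
have [B [_ [_ mul_bounded inv_bounded mul_over inv_over]]] := G_group.
exists tauP; split.
- exact: (tau_hausdorff K_strong_limit M_saturated M_homogeneous smallW
    hE_over tr_over cl_over tauE localb).
- exact: (tau_locally_compact K_strong_limit M_saturated smallW tauE localb).
- apply: (definable_op_continuous K_strong_limit M_saturated M_homogeneous
    smallW hE_over tr_over cl_over tauE localb) => // i j k.
  apply: (T1_preim3_over K_strong_limit M_saturated M_homogeneous smallW
    fixA overA T1A); exact: (mul_over i j k).1.
- apply: (definable_map_continuous K_strong_limit M_saturated M_homogeneous
    smallW tauE) => // i j.
  apply: (T1_preim2_over K_strong_limit M_saturated M_homogeneous smallW
    fixA overA T1A); exact: (inv_over i j).1.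
Qed.

Lemma locally_compact_group_global tau : logic_topology tau ->
  locally_compact_group (G := G) tau -> global_logic_topology tau.
Proof.
move=> ltau [tauP [haus _ _ _]]; split=> // x y xy.
move: haus; rewrite open_hausdorff => /(_ x y).
move=> [|[U V] /= [xU yV] [oU oV /eqP UV]].
  exact/eqP.
rewrite !inE in xU yV; exists U; split=> // Uy.
by have : set0 y by rewrite -UV.
Qed.

Lemma locally_compact_group_local tau : countably_piecewise G ->
  logic_topology tau -> locally_compact_group (G := G) tau ->
  locally_hyperdefinable G.
Proof.
move=> [C [countC cofC]] ltau lcG.
have [_ T1] := locally_compact_group_global ltau lcG.
move: ltau T1 lcG => [A [smallA overA ->]] T1A.
have [_ [W [b [smallW fixA]]]] := smallA.
move=> [tauP [haus lc mulC _]].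
have range_over (i : pindex G) :
    pw_bigwedge A (range (@dlim_in _ _ _ G i)).
  apply/(T1_pw_bigwedgeE K_strong_limit M_saturated M_homogeneous smallW fixA
    overA T1A).
  apply: (pw_definable_piece K_strong_limit M_saturated M_homogeneous smallW).
  - exact: piece_hX_over fixA overA.
  - exact: piece_transition_over fixA overA.
pose X := tau_space tauP.
have closedE (D : set X) : closed D <-> pw_bigwedge A D.
  by rewrite -openC tau_space_openE /logic_open /= setCK.
have /pcard_leP[f] := countC.
have finj : {in C &, injective f} by exact: inj.
(* The piece numbered [n], or the empty set when [n] numbers none. *)
pose F n : set X :=
  [set x | exists i, [/\ C i, f i = n & range (@dlim_in _ _ _ G i) x]].
have FE i : C i -> F (f i) = range (@dlim_in _ _ _ G i).
  move=> Ci; apply/seteqP; split=> x; last by exists i.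
  by move=> [j [Cj /finj ji]]; rewrite ji ?inE.
have clF n : closed (F n).
  have [[i [Ci <-]]|nC] := pselect (exists i, C i /\ f i = n).
    by rewrite FE//; exact/closedE.
  rewrite (_ : F n = set0); first exact: closed0.
  by apply/seteqP; split=> // x [i [Ci fi _]]; apply: nC; exists i.
have [n [U [oU [g Ug] UF]]] : exists n (U : set X),
    [/\ open U, U !=set0 & U `<=` F n].
  apply: (locally_compact_baire haus lc _ clF).
    exact: (1%g : pw_groupType G).
  move=> x; have [i [c ->]] := dlim_ex x; have [j Cj ij] := cofC i.
  by exists (f j); rewrite FE//; apply: (range_dlim_in_le ij); exists c.
have [i [Ci fi _]] := UF g Ug.
exists A; split=> // x.
have [B [_ [_ mul_bounded _ _ _]]] := G_group.
(* Left translation by [h] sends [x] to the interior point [g]; piece [l] contains the inverse of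
   [h], and piece [k] all products of pieces [l] and [i]. *)
pose h := pw_mul g (pw_inv x); have [l [c hc]] := dlim_ex (pw_inv h).
have [k kP] := mul_bounded l i.
exists (range (@dlim_in _ _ _ G k)), [set z | U (pw_mul h z)]; split.
- exact: range_over.
- by exists k.
- have : @open X ((fun z => pw_mul h z) @^-1` U).
    have hC : continuous (fun z : X => pw_mul h z : X).
      move=> z V /(mulC (h, z))[[Q1 Q2] /= [nQ1 nQ2] QV].
      apply: filterS nQ2 => w Q2w; apply: (QV (h, w)).
      by split=> //; exact: nbhs_singleton nQ1.
    by move/continuousP: hC; exact.
  by rewrite tau_space_openE.
- rewrite /h /= (_ : pw_mul _ x = g)//.
  by rewrite /pw_mul /pw_inv; exact: (@mulgVK (pw_groupType G) x g).
(* The translate of [z] by [h] lies in piece [i], so multiplying back by the inverse of [h] puts [z]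
   in piece [k]. *)
- move=> z /UF; rewrite -fi FE// => -[d _ dz].
  rewrite (_ : z = pw_mul (pw_inv h) (pw_mul h z)).
    by rewrite hc -dz; exact: kP.
  by rewrite /pw_mul /pw_inv; exact: esym (@mulKg (pw_groupType G) h z).
Qed.

End Group.

Theorem theorem2p19 (L : language) (M : structure L) (K : Type)
  (K_strong_limit : strong_limit K)
  (L_small : card_lt (language_card L) K)
  (M_saturated : saturated M K)
  (M_homogeneous : strongly_homogeneous M K)
  (G : pw_group M K)
  (G_group : piecewise_hyperdefinable_group G) :
  (locally_hyperdefinable G ->
    forall tau, global_logic_topology tau -> locally_compact_group (G := G) tau) /\
  (countably_piecewise G ->
    forall tau, logic_topology tau ->
      (locally_compact_group (G := G) tau <->
       global_logic_topology tau /\ locally_hyperdefinable G)).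
Proof.
split=> [loc tau|count tau ltau]; first exact: global_locally_compact_group.
split=> [lcG|[glob loc]]; last exact: global_locally_compact_group.
split; first exact: locally_compact_group_global lcG.
exact: locally_compact_group_local lcG.
Qed.
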